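(* Let $c' := 2\log 2$. For every real $\delta$ with $0<\delta<1$, the set $$G_\delta := \big\{ n \text{ an odd positive integer},\ n\ge 3 \;:\; T(n) \le n\,(\log n)^{-c'(1-\delta)} \big\}$$ has relative density $1$ among the odd positive integers; that is, the inequality $T(n)\le n(\log n)^{-c'(1-\delta)}$ holds for almost all odd $n$.
   Context: $\sigma(n)=\sum_{d\mid n} d$ is the sum-of-divisors function and $v_2(m)$ is the exponent of $2$ in the positive integer $m$. For an odd positive integer $n$, $T(n) := \sigma(n)/2^{v_2(\sigma(n))}$ is the odd part of $\sigma(n)$. $\log$ is the natural logarithm. For a set $A$ of odd positive integers, the relative density of $A$ among the odd integers is $\lim_{x\to\infty} \#(A\cap[1,x])/\#\{n\le x : n \text{ odd positive integer}\}$, when the limit exists. A property holds for almost all odd $n$ if the set of odd $n$ for which it fails has relative density $0$ among the odd integers. *)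

(* Defs.v *)
From mathcomp Require Import all_boot all_order all_algebra finmap.
From mathcomp Require Import all_classical all_reals all_analysis.

Set Implicit Arguments.
Unset Strict Implicit.
Unset Printing Implicit Defensive.

Import Order.TTheory GRing.Theory Num.Theory.
Import numFieldNormedType.Exports.

Local Open Scope classical_set_scope.
Local Open Scope ring_scope.

Definition sigma (n : nat) : nat := (\sum_(d <- divisors n) d)%N.

Definition T (n : nat) : nat := (sigma n %/ 2 ^ logn 2 (sigma n))%N.

(* #(A ∩ [1, x]) for a real x; the set is always finite, so [fset_set] does
   not fall back to its default value. *)
Definition count_upto (R : realType) (A : set nat) (x : R) : nat :=
  #|` fset_set (A `&` [set n : nat | (1 <= n)%N /\ n%:R <= x]) |.

Definition odd_set : set nat := [set n : nat | odd n].

(* The limit is over real x; the quotient is meaningful as soon as 1 <= x. *)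
Definition has_odd_density (R : realType) (A : set nat) (l : R) : Prop :=
  (count_upto A (x : R))%:R / (count_upto odd_set (x : R))%:R
    @[x --> +oo%R] --> l.

Definition almost_all_odd (R : realType) (P : nat -> Prop) : Prop :=
  has_odd_density [set n : nat | odd n /\ ~ P n] (0 : R).

Definition c' (R : realType) : R := 2 * ln 2.

(* At n = 1, where ln n = 0, [powR] makes the right-hand side 0, so the
   inequality is false there; one integer does not affect densities. *)
Definition T_bound (R : realType) (delta : R) (n : nat) : Prop :=
  (T n)%:R <= n%:R * (ln (n%:R : R)) `^ (- (c' R * (1 - delta))).

Definition G (R : realType) (delta : R) : set nat :=
  [set n : nat | [/\ odd n, (3 <= n)%N & T_bound delta n]].

(* Main.v *)
(**
Write [l = ln (ln x)].  For almost all odd [n <= x] one has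
[logn 2 (sigma n) >= (2 - o(1)) l] while [sigma n / n] is at most any fixed
power of [ln x]; dividing gives the bound on [T n].

The second fact is Markov's inequality, the mean of [sigma n / n] being at most
2.  For the first, every prime [p] exactly dividing [n] contributes the factor
[p + 1] to [sigma n], so [logn 2 (sigma n)] dominates, up to a bounded mean
coming from square divisors, the additive function
[f n = \sum_(p %| n) min (logn 2 (p + 1)) K].  By Turan's variance argument [f]
is concentrated around
[\sum_(p <= sqrt x) min (logn 2 (p + 1)) K / p], which is
[(2 - 2 / 2 ^ K) l + O(1)] because the primes [p = -1 mod 2 ^ (k + 1)] have
logarithmic density [1 / 2 ^ k].

That density is Dirichlet's theorem modulo powers of 2 in Mertens' form, proved
in the elementary way: for a nonprincipal character [chi] with
[L = \sum chi n / n], the sum [\sum_(n <= x) chi n * mangoldt n / n] is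
bounded if [L <> 0] and is [- ln x + O(1)] if [L = 0].  The latter contradicts
[3 + 4 cos t + cos 2t >= 0] unless [chi ^ 2] is principal, and then [chi] is one
of the three real characters modulo 8, for which [L > 0] is seen by grouping
terms.
*)
Require Import Defs.
From mathcomp Require Import all_boot all_order all_algebra finmap.
From mathcomp Require Import all_classical all_reals all_analysis.
From mathcomp Require Import complex zify ring lra.

Import Order.TTheory GRing.Theory Num.Theory.
Import numFieldNormedType.Exports.

Local Open Scope classical_set_scope.
Local Open Scope complex_scope.
Local Open Scope ring_scope.

Set Implicit Arguments.
Unset Strict Implicit.
Unset Printing Implicit Defensive.

Local Notation normc := Normc.normc.
Local Notation Re := complex.Re.
Local Notation Im := complex.Im.

(** * The von Mangoldt and Moebius functions *)

(** The exponent [c'] arises as follows: weighted by [1 / p], the valuation [logn 2 (p + 1)] has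
    mean [1 + 1/2 + 1/4 + ... = 2] over odd primes, a typical [n <= x] has about [ln (ln x)] prime
    factors, and [2 ^ (2 * ln (ln x)) = (ln x) ^ (2 * ln 2)]. The cap [K] answers two obstacles.
    Turan's bound needs the second moment of the weights to be controlled by the mean, hence bounded
    weights; and each progression comes with its own unspecified [O(1)], so only finitely many
    moduli, fixed before [x], can be used. Since only a lower bound on the valuation is wanted, the
    cap costs no more than the factor deficit [2 / 2 ^ K]. The restriction to [p <= sqrt x] comes
    from rounding: counting the odd [n <= x] divisible by [p * q] has an error [O(1)] for each pair,
    which totals [O(x)] for fixed [K] only if [p] and [q] stay below [sqrt x]. Almost nothing is
    lost, because [ln (ln (sqrt x)) = ln (ln x) - ln 2]. All estimates on characters are made on
    finite sums; a limit enters only to define the value [L]. *)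

Lemma sum_hyperbola (V : nmodType) (x : nat) (F : nat -> nat -> V) :
  \sum_(1 <= d < x.+1) \sum_(1 <= m < (x %/ d).+1) F d m =
  \sum_(1 <= n < x.+1) \sum_(1 <= d < n.+1 | (d %| n)%N) F d (n %/ d)%N.
Proof.
have -> : \sum_(1 <= n < x.+1) \sum_(1 <= d < n.+1 | (d %| n)%N) F d (n %/ d)%N =
    \sum_(1 <= n < x.+1) \sum_(1 <= d < x.+1 | (d %| n)%N) F d (n %/ d)%N.
  rewrite big_nat_cond [RHS]big_nat_cond; apply: eq_bigr => n /andP[/andP[n1 nx] _].
  rewrite [RHS](big_cat_nat _ (n := n.+1)) //=.
  rewrite [X in _ = _ + X]big_nat_cond [X in _ = _ + X]big1 ?addr0 // => d.
  by move=> /andP[/andP[nd _] /dvdn_leq]; lia.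
rewrite (exchange_big_dep_nat xpredT) //=.
rewrite big_nat_cond [RHS]big_nat_cond; apply: eq_bigr => d /andP[/andP[d1 dx] _].
(* For fixed [d] the quotient [x %/ d] grows by one exactly when [d] divides the new [x]. *)
elim: x {dx} => [|x IH]; first by rewrite div0n !big_geq.
rewrite [RHS]big_mkcond big_nat_recr //= -big_mkcond /= -IH.
case: ifPn => [dvd|ndvd].
  have -> : (x.+1 %/ d)%N = (x %/ d).+1 by rewrite divnS ?dvd ?add1n.
  by rewrite [LHS]big_nat_recr.
by rewrite addr0 divnS // (negbTE ndvd).
Qed.

Lemma sum_hyperbola_swap (V : nmodType) (x : nat) (F : nat -> nat -> V) :
  \sum_(1 <= d < x.+1) \sum_(1 <= m < (x %/ d).+1) F d m =
  \sum_(1 <= m < x.+1) \sum_(1 <= d < (x %/ m).+1) F d m.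
Proof.
have cut d : (0 < d)%N -> forall G : nat -> V,
    \sum_(1 <= m < (x %/ d).+1) G m = \sum_(1 <= m < x.+1 | (d * m <= x)%N) G m.
  move=> d0 G; rewrite [RHS](big_cat_nat _ (n := (x %/ d).+1)) ?ltnS ?leq_div //=.
  rewrite [X in _ = _ + X]big_nat_cond [X in _ = _ + X]big1 ?addr0; last first.
    by move=> m /andP[/andP[m1 _]]; rewrite mulnC -leq_divRL //; lia.
  rewrite big_nat_cond [RHS]big_nat_cond; apply: eq_bigl => m.
  by rewrite andbT mulnC -leq_divRL //; case: (1 <= m)%N => //=; rewrite ltnS andbb.
transitivity (\sum_(1 <= d < x.+1) \sum_(1 <= m < x.+1 | (d * m <= x)%N) F d m).
  rewrite big_nat_cond [RHS]big_nat_cond; apply: eq_bigr => d /andP[/andP[d1 dx] _].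
  exact: cut.
rewrite (exchange_big_dep_nat xpredT) //=.
rewrite big_nat_cond [RHS]big_nat_cond; apply: eq_bigr => m /andP[/andP[m1 mx] _].
by rewrite cut //; apply: eq_bigl => d; rewrite mulnC.
Qed.

Definition mangoldt (R : realType) (n : nat) : R :=
  if size (primes n) == 1%N then ln (pdiv n)%:R else 0.

Lemma mangoldt_ge0 (R : realType) n : 0 <= mangoldt R n.
Proof.
by rewrite /mangoldt; case: ifP => // _; rewrite ln_ge0 // ler1n pdiv_gt0.
Qed.

Lemma mangoldt1 (R : realType) : mangoldt R 1 = 0.
Proof. by []. Qed.

Lemma mangoldt_pfactor (R : realType) p k : prime p ->
  mangoldt R (p ^ k.+1) = ln p%:R.
Proof.
by move=> pp; rewrite /mangoldt primesX // primes_prime //= pdiv_pfactor.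
Qed.

Lemma mangoldt_prime (R : realType) p : prime p -> mangoldt R p = ln p%:R.
Proof. by move=> pp; rewrite -[in LHS](expn1 p) mangoldt_pfactor. Qed.

Lemma mangoldt_neq0 (R : realType) n : mangoldt R n != 0 ->
  exists2 p, prime p & exists k, n = (p ^ k.+1)%N.
Proof.
rewrite /mangoldt; case: ifP => [/eqP sz _|]; last by rewrite eqxx.
case E: (primes n) sz => [|p [|? ?]] //= _.
have : p \in primes n by rewrite E inE.
rewrite mem_primes => /and3P[pp n0 pn]; exists p => //.
have pnat : p.-nat n.
  apply/pnatP => // q pq qn; have : q \in primes n by rewrite mem_primes pq n0.
  by rewrite E inE.
have [k nk] := p_natP pnat.
case: k nk => [n1|k ->]; last by exists k.
by move: pn; rewrite n1 dvdn1 => /eqP p1; move: pp; rewrite p1.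
Qed.

Lemma sum_mangoldt_divisors (R : realType) n : (0 < n)%N ->
  \sum_(1 <= d < n.+1 | (d %| n)%N) mangoldt R d = ln n%:R.
Proof.
elim/ltn_ind: n => n IH n0.
have [n1|n1] := leqP n 1.
  have -> : n = 1%N by lia.
  by rewrite big_mkcond big_nat1 /= ln1.
have [p pp pn] := pdivP n1.
have [m nm] : exists m, n = (p * m)%N by exists (n %/ p)%N; rewrite mulnC divnK.
have p1 := prime_gt1 pp.
have m0 : (0 < m)%N by case: m nm n0 => //; rewrite muln0 => ->.
have mn : (m < n)%N by nia.
have -> : ln n%:R = ln m%:R + ln p%:R :> R.
  by rewrite nm natrM lnM 1?addrC ?posrE ?ltr0n // ltnW.
rewrite -IH //.
rewrite (bigID (fun d => d %| m)%N) /=; congr (_ + _).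
  rewrite (big_cat_nat _ (n := m.+1)) ?ltnS ?(ltnW mn) //=.
  rewrite [X in _ + X]big_nat_cond [X in _ + X]big1 ?addr0; last first.
    by move=> d /andP[/andP[md _] /andP[_ /dvdn_leq]]; lia.
  by apply: eq_bigl => d; case dm: (d %| m)%N; rewrite ?andbF // nm dvdn_mull.
(* Passing from [m] to [n = p * m] creates a single new prime-power divisor, this [q]; [mangoldt]
   vanishes at every other new divisor. *)
set q := (p ^ (logn p m).+1)%N.
have qn : (q %| n)%N by rewrite nm /q expnS dvdn_mul // pfactor_dvdnn.
have qm : ~~ (q %| m)%N by rewrite /q pfactor_dvdn // ltnn.
have qin : q \in index_iota 1 n.+1.
  by rewrite mem_index_iota ltnS (dvdn_leq _ qn) // andbT /q expn_gt0 (ltnW p1).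
rewrite (big_rem q) //= qn qm /= mangoldt_pfactor // big_seq_cond big1 ?addr0 //.
move=> d /and3P[]; rewrite mem_rem_uniq ?iota_uniq // inE => /andP[dq _] dn dm.
apply/eqP; apply: contraNT dm => /mangoldt_neq0[r pr [k dk]].
have [rp|rp] := eqVneq r p.
  move: dn dq; rewrite dk rp nm !pfactor_dvdn ?muln_gt0 ?m0 ?(ltnW p1) //.
  rewrite lognM ?(ltnW p1) // logn_prime // eqxx => dn.
  by rewrite /q eqn_exp2l // => kk; lia.
move: dn; rewrite dk nm Gauss_dvdr // coprimeXl // prime_coprime //.
by rewrite dvdn_prime2.
Qed.

Definition moebius (n : nat) : int :=
  if all (fun p => logn p n == 1)%N (primes n) then (-1) ^+ size (primes n) else 0.

Lemma moebius1 : moebius 1 = 1.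
Proof. by []. Qed.

Lemma norm_moebius n : `|moebius n| <= 1.
Proof.
by rewrite /moebius; case: ifP => _; rewrite ?normr0 // normrX normrN1 expr1n.
Qed.

Lemma moebius_sq p d : prime p -> (0 < d)%N -> (p ^ 2 %| d)%N -> moebius d = 0.
Proof.
move=> pp d0 pd; rewrite /moebius ifF //; apply/negbTE/allPn; exists p.
  by rewrite mem_primes pp d0 (dvdn_trans _ pd) // dvdn_exp.
by move: pd; rewrite pfactor_dvdn //; lia.
Qed.

Lemma moebius_mulp p d : prime p -> (0 < d)%N -> ~~ (p %| d)%N ->
  moebius (p * d) = - moebius d.
Proof.
move=> pp d0 pd; have p0 := prime_gt0 pp.
have prm : perm_eq (primes (p * d)) (p :: primes d).
  apply: uniq_perm; rewrite /= ?primes_uniq ?andbT ?mem_primes ?(negbTE pd) ?andbF //.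
  by move=> q; rewrite primesM ?p0 // primes_prime // !inE.
have lp q : q \in primes d -> logn q (p * d) = logn q d.
  rewrite mem_primes => /and3P[pq _ qd]; rewrite lognM // logn_prime //.
  by case: eqP => // qp; move: qd; rewrite qp (negbTE pd).
rewrite /moebius (perm_all _ prm) (perm_size prm) /=.
rewrite lognM // logn_prime // eqxx (eqP (_ : logn p d == 0)%N); last first.
  by rewrite -leqn0 leqNgt logn_gt0 mem_primes (negbTE pd) !andbF.
rewrite addn0 /= (eq_in_all (a2 := fun q => logn q d == 1)%N); last first.
  by move=> q /lp ->.
by case: ifP; rewrite ?oppr0 // exprS mulN1r.
Qed.

Lemma sum_moebius n : (1 < n)%N ->
  \sum_(1 <= d < n.+1 | (d %| n)%N) moebius d = 0.
Proof.
move=> n1; have [p pp pn] := pdivP n1; have p1 := prime_gt1 pp.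
have [m nm] : exists m, n = (p * m)%N by exists (n %/ p)%N; rewrite mulnC divnK.
have m0 : (0 < m)%N by lia.
(* The terms [d] and [p * d] with [p] not dividing [d] cancel. *)
rewrite (bigID (fun d => p %| d)%N) /= addrC.
have pos d : (d %| n)%N -> (0 < d)%N by apply: dvdn_gt0; lia.
have E : \sum_(1 <= d < n.+1 | (d %| n)%N && (p %| d)%N) moebius d =
    \sum_(1 <= e < n.+1 | (e %| n)%N && ~~ (p %| e)%N) moebius (p * e).
  (* Terms with [p ^ 2 %| d] are zero, so the condition on [d %/ p] is free. *)
  transitivity (\sum_(1 <= d < n.+1 | (p %| d)%N)
      if (d %| n)%N && ~~ (p %| d %/ p)%N then moebius d else 0).
    rewrite big_mkcondl /=; apply: eq_bigr => d pd.
    case dn: (d %| n)%N => //=; case: ifPn => //; rewrite negbK => pdp.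
    apply: (moebius_sq pp); first exact: pos.
    by rewrite -[d](divnK pd) expnS expn1 dvdn_mul.
  (* The substitution [d = p * e] goes through a double sum in which each [d] meets exactly one
     [e]. *)
  transitivity (\sum_(1 <= d < n.+1 | (p %| d)%N)
     \sum_(1 <= e < n.+1 | d == (p * e)%N)
       if (d %| n)%N && ~~ (p %| d %/ p)%N then moebius d else 0).
    rewrite big_nat_cond [RHS]big_nat_cond; apply: eq_bigr => d /andP[/andP[d1 dn] pd].
    rewrite (big_rem (d %/ p)%N) /=; last first.
      rewrite mem_index_iota divn_gt0 ?prime_gt0 // dvdn_leq //=.
      by rewrite (leq_ltn_trans (leq_div _ _)).
    rewrite mulnC divnK // eqxx big_seq_cond big1 ?addr0 // => e /andP[].
    rewrite mem_rem_uniq ?iota_uniq // inE => /andP[ne _] /eqP de.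
    by move: ne; rewrite de mulKn ?eqxx ?prime_gt0.
  rewrite (exchange_big_dep_nat xpredT) //=.
  rewrite [RHS]big_mkcond /= big_nat_cond [RHS]big_nat_cond.
  apply: eq_bigr => e /andP[/andP[e1 en] _].
  have [pe|pe] := boolP (p %| e)%N.
    rewrite andbF big1 // => d /andP[_ /eqP ->].
    by rewrite mulKn ?prime_gt0 // pe andbF.
  have Q : (e %| n)%N = (p * e %| n)%N.
    by rewrite nm dvdn_pmul2l ?prime_gt0 // Gauss_dvdr // coprime_sym prime_coprime.
  rewrite andbT Q; case: ifPn => pen.
    rewrite (big_rem (p * e)%N) /=; last first.
      by rewrite mem_index_iota muln_gt0 prime_gt0 //= e1 ltnS dvdn_leq //; lia.
    rewrite dvdn_mulr // eqxx pen mulKn ?prime_gt0 // pe /=.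
    rewrite big_seq_cond big1 ?addr0 // => d /andP[].
    by rewrite mem_rem_uniq ?iota_uniq // inE => /andP[/negbTE ->]; rewrite andbF.
  by rewrite big1 // => d /andP[_ /eqP ->]; rewrite (negbTE pen).
rewrite E -big_split /= big1 // => d /andP[dn pd].
by rewrite moebius_mulp ?addrN // pos.
Qed.

(** * Chebyshev's and Mertens' estimates *)

Lemma sum_ln_mangoldt (R : realType) x :
  \sum_(1 <= n < x.+1) ln n%:R =
  \sum_(1 <= d < x.+1) mangoldt R d * (x %/ d)%:R.
Proof.
rewrite (eq_big_nat _ _ (F2 := fun n =>
   \sum_(1 <= d < n.+1 | (d %| n)%N) mangoldt R d)); last first.
  by move=> n /andP[n1 _]; rewrite sum_mangoldt_divisors.
rewrite -(sum_hyperbola x (fun d _ => mangoldt R d)); apply: eq_bigr => d _.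
by rewrite sumr_const_nat subSS subn0 mulr_natr.
Qed.

Lemma ln_factorial (R : realType) n :
  ln (n`!%:R : R) = \sum_(1 <= i < n.+1) ln i%:R.
Proof.
elim: n => [|n IH]; first by rewrite big_geq // fact0 ln1.
by rewrite factS natrM lnM ?posrE ?ltr0n ?fact_gt0 // IH addrC -big_nat_recr.
Qed.

Lemma leq_bin_exp n m : ('C(n, m) <= 2 ^ n)%N.
Proof.
have [nm|mn] := ltnP n m; first by rewrite bin_small.
rewrite -[2%N]/(1 + 1)%N expnDn (bigD1 (inord m)) //= inordK ?ltnS //.
by rewrite !exp1n !muln1 leq_addr.
Qed.

(** By Legendre's formula [sum_ln_mangoldt], the logarithm of the central binomial coefficient is
    the sum of [mangoldt d] times [floor (2 m / d) - 2 floor (m / d)]. This factor is never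
    negative, and it is at least 1 for [m < d <= 2 m]. *)
Lemma sum_mangoldt_double (R : realType) m :
  \sum_(m.+1 <= d < (m.*2).+1) mangoldt R d <= m.*2%:R * ln 2.
Proof.
have bin : ln ('C(m.*2, m)%:R : R) =
    \sum_(1 <= i < (m.*2).+1) ln i%:R - 2 * \sum_(1 <= i < m.+1) ln i%:R.
  rewrite -!ln_factorial -(@bin_fact m.*2 m) -addnn ?leq_addr // addnK.
  rewrite !natrM !lnM ?posrE ?mulr_gt0 ?ltr0n ?fact_gt0 ?bin_gt0 ?leq_addr //.
  by ring.
have le : ln ('C(m.*2, m)%:R : R) <= m.*2%:R * ln 2.
  rewrite mulr_natl -lnXn // ler_ln ?posrE ?exprn_gt0 ?ltr0n ?bin_gt0 -?addnn ?leq_addr //.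
  by rewrite -natrX ler_nat leq_bin_exp.
apply: le_trans le; rewrite bin !sum_ln_mangoldt.
have mm : (m < m.*2.+1)%N by rewrite ltnS -addnn leq_addr.
rewrite [X in _ <= X - _](big_cat_nat _ (n := m.+1)) //= addrAC.
rewrite -[X in X <= _]add0r lerD //.
  rewrite mulr_sumr subr_ge0 ler_sum // => d _.
  rewrite mulrCA ler_wpM2l ?mangoldt_ge0 // -natrM ler_nat.
  have [->|d0] := posnP d; first by rewrite !divn0.
  by rewrite leq_divRL // -mulnA mul2n leq_double leq_divM.
rewrite ler_sum_nat // => d /andP[md dm].
rewrite ler_peMr ?mangoldt_ge0 // ler1n divn_gt0 //; lia.
Qed.

Lemma sum_mangoldt_expn2 (R : realType) k :
  \sum_(1 <= d < (2 ^ k).+1) mangoldt R d <= (2 ^ k.+1)%:R * ln 2.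
Proof.
elim: k => [|k IH].
  by rewrite big_nat1 mangoldt1 mulr_ge0 // ln_ge0 // ler1n.
rewrite (big_cat_nat _ (n := (2 ^ k).+1)) ?ltnS ?leq_exp2l //=.
rewrite (_ : 2 ^ k.+1 = (2 ^ k).*2)%N; last by rewrite expnS mul2n.
have := sum_mangoldt_double R (2 ^ k).
move: IH; rewrite (expnS 2 k.+1) expnS mul2n -!addnn !natrD; lra.
Qed.

(** With [2 ^ k <= x < 2 ^ k.+1], the sum up to [2 ^ k.+1] is at most [2 ^ k.+2 * ln 2]; then
    [ln 2 <= 1] gives the 4. *)
Lemma chebyshev_psi (R : realType) x :
  \sum_(1 <= d < x.+1) mangoldt R d <= 4 * x%:R.
Proof.
have [->|x0] := posnP x; first by rewrite big_geq // mulr0.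
have [k1 k2] : (2 ^ trunc_log 2 x <= x)%N /\ (x < 2 ^ (trunc_log 2 x).+1)%N.
  by rewrite trunc_logP // trunc_log_ltn.
set k := trunc_log 2 x in k1 k2.
have ln2 : ln 2 <= 1 :> R by rewrite (le_trans (@le_ln1Dx R 1 _)) ?lerDl //; lra.
apply: (@le_trans _ _ (\sum_(1 <= d < (2 ^ k.+1).+1) mangoldt R d)).
  rewrite [leRHS](big_cat_nat _ (n := x.+1)) ?ltnS //=; last exact: ltnW.
  by rewrite lerDl sumr_ge0 // => d _; exact: mangoldt_ge0.
apply: (le_trans (sum_mangoldt_expn2 _ _)).
have : (2 ^ k)%:R <= x%:R :> R by rewrite ler_nat.
have : 0 <= (2 ^ k)%:R :> R by [].
rewrite 2!expnS !natrM; nra.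
Qed.

(** Half of Stirling's formula; the induction step amounts to [x * ln (1 + 1 / x) <= 1]. *)
Lemma sum_ln_ge (R : realType) x :
  x%:R * ln x%:R - x%:R <= \sum_(1 <= n < x.+1) ln (n%:R : R).
Proof.
elim: x => [|x IH]; first by rewrite big_geq // mul0r subr0.
rewrite big_nat_recr //=; apply: le_trans (lerD IH (lexx _)).
have [->|x0] := posnP x; first by rewrite mul0r ln1; lra.
have xR : 0 < x%:R :> R by rewrite ltr0n.
have E : ln (x.+1%:R : R) = ln x%:R + ln (1 + x%:R^-1).
  rewrite -lnM ?posrE ?addr_gt0 ?invr_gt0 // mulrDr mulr1 divff ?gt_eqF //.
  by rewrite -natr1.
have H : x%:R * ln (1 + x%:R^-1) <= 1 :> R.
  rewrite -ler_pdivlMl // mulr1 le_ln1Dx // (lt_trans (_ : -1 < 0)) ?invr_gt0 //; lra.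
rewrite E -[x.+1%:R]natr1; nra.
Qed.

Lemma sum_ln_le (R : realType) x :
  \sum_(1 <= n < x.+1) ln (n%:R : R) <= x%:R * ln x%:R.
Proof.
have -> : x%:R * ln x%:R = \sum_(1 <= n < x.+1) ln (x%:R : R).
  by rewrite sumr_const_nat subSS subn0 mulr_natl.
rewrite ler_sum_nat // => n /andP[n1 nx].
by rewrite ler_ln ?posrE ?ltr0n ?ler_nat //; lia.
Qed.

(** Both bounds compare [x / d] with its floor in [sum_ln_mangoldt]. The 1 is Stirling's loss; the 4
    is Chebyshev's constant, since the rounding errors total at most the sum of [mangoldt d]. *)
Lemma mertens_mangoldt (R : realType) x : (0 < x)%N ->
  ln x%:R - 1 <= \sum_(1 <= n < x.+1) mangoldt R n / n%:R <= ln x%:R + 4.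
Proof.
move=> x0; have xR : 0 < x%:R :> R by rewrite ltr0n.
have := sum_ln_ge R x; have := sum_ln_le R x.
rewrite sum_ln_mangoldt => up lo.
have := chebyshev_psi R x => ch.
have le1 : \sum_(1 <= d < x.+1) mangoldt R d * (x %/ d)%:R <=
    x%:R * \sum_(1 <= n < x.+1) mangoldt R n / n%:R.
  rewrite mulr_sumr ler_sum_nat // => d /andP[d1 _].
  rewrite mulrCA ler_wpM2l ?mangoldt_ge0 // ler_pdivlMr ?ltr0n //.
  by rewrite -natrM ler_nat leq_divM.
have le2 : x%:R * \sum_(1 <= n < x.+1) mangoldt R n / n%:R <=
    \sum_(1 <= d < x.+1) mangoldt R d * (x %/ d)%:R + \sum_(1 <= d < x.+1) mangoldt R d.
  rewrite -big_split /= mulr_sumr ler_sum_nat // => d /andP[d1 _].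
  rewrite mulrCA -[X in _ <= _ + X]mulr1 -mulrDr ler_wpM2l ?mangoldt_ge0 //.
  rewrite ler_pdivrMr ?ltr0n // natr1 -natrM ler_nat ltnW //.
  by rewrite {1}(divn_eq x d) mulSn addnC ltn_add2r ltn_pmod.
apply/andP; split; rewrite -(ler_pM2l xR).
  by apply: le_trans le1; apply: le_trans lo; rewrite mulrBr mulr1.
apply: (le_trans le2); rewrite mulrDr; lra.
Qed.

(** * Complex characters and their logarithmic sums *)

Lemma normc_ge0 (R : rcfType) (z : R[i]) : 0 <= normc z.
Proof. by case: z => a b; exact: sqrtr_ge0. Qed.

Lemma normc_real (R : rcfType) (a : R) : normc a%:C = `|a|.
Proof. by rewrite /= expr0n addr0 sqrtr_sqr. Qed.

Lemma normc_add (R : rcfType) (y z : R[i]) : normc (y + z) <= normc y + normc z.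
Proof. exact: le_normcD. Qed.

Lemma normc_opp (R : rcfType) (z : R[i]) : normc (- z) = normc z.
Proof. exact: normcN. Qed.

Lemma normc_sum (R : rcfType) I (r : seq I) (P : pred I) (F : I -> R[i]) :
  normc (\sum_(i <- r | P i) F i) <= \sum_(i <- r | P i) normc (F i).
Proof.
elim/big_ind2: _ => [|x1 x2 y1 y2 h1 h2|//]; first by rewrite Normc.normc0.
exact: le_trans (normc_add _ _) (lerD h1 h2).
Qed.

Lemma normc_ge_absRe (R : rcfType) (z : R[i]) : `|Re z| <= normc z.
Proof.
case: z => a b /=; rewrite -sqrtr_sqr ler_wsqrtr // lerDl; exact: sqr_ge0.
Qed.

Lemma normc_ge_absIm (R : rcfType) (z : R[i]) : `|Im z| <= normc z.
Proof.
case: z => a b /=; rewrite -sqrtr_sqr ler_wsqrtr // lerDr; exact: sqr_ge0.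
Qed.

Lemma normc_le_ReIm (R : rcfType) (z : R[i]) : normc z <= `|Re z| + `|Im z|.
Proof.
case: z => a b /=; rewrite -[leRHS]ger0_norm ?addr_ge0 // -[leRHS]sqrtr_sqr ler_wsqrtr //.
rewrite sqrrD !real_normK ?num_real // lerD2r lerDl mulrn_wge0 // mulr_ge0 //.
Qed.

Lemma ReB (R : rcfType) (y z : R[i]) : Re (y - z) = Re y - Re z.
Proof. by case: y z => [a b] [c d]. Qed.

Lemma ImB (R : rcfType) (y z : R[i]) : Im (y - z) = Im y - Im z.
Proof. by case: y z => [a b] [c d]. Qed.

(** The intervals of centre [u n] and radius [c n] meet pairwise, so the supremum of their left ends
    lies in all of them. This yields a limit together with its rate. *)
Lemma exists_nested_point (R : realType) (u c : nat -> R) :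
  (forall m n, u n - c n <= u m + c m) ->
  exists l, forall n, `|u n - l| <= c n.
Proof.
move=> uc; pose A := [set u n - c n | n in [set: nat]].
have A0 : A !=set0 by exists (u 0%N - c 0%N), 0%N.
have ubA m : ubound A (u m + c m) by move=> _ [n _ <-]; exact: uc.
exists (sup A) => n; rewrite ler_distlC; apply/andP; split.
  by apply: ub_le_sup; [exists (u 0%N + c 0%N)|exists n].
exact: ge_sup.
Qed.

(** Real and imaginary parts are treated separately, whence the factor 2. *)
Lemma exists_nested_complex (R : realType) (u : nat -> R[i]) (c : nat -> R) :
  (forall m n, (n <= m)%N -> normc (u m - u n) <= c n) -> (forall n, 0 <= c n) ->
  exists l, forall n, normc (u n - l) <= 2 * c n.
Proof.
move=> uc c0.
have key (f : R[i] -> R) : (forall y z, f (y - z) = f y - f z) ->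
    (forall z, `|f z| <= normc z) -> exists l, forall n, `|f (u n) - l| <= c n.
  move=> fB fle; apply: (@exists_nested_point R (f \o u) c) => m n /=.
  have [nm|mn] := leqP n m.
    have := le_trans (fle _) (uc _ _ nm); rewrite fB ler_norml; have := c0 m; lra.
  have := le_trans (fle _) (uc _ _ (ltnW mn)); rewrite fB ler_norml; have := c0 n; lra.
have [a ha] := key _ (@ReB R) (@normc_ge_absRe R).
have [b hb] := key _ (@ImB R) (@normc_ge_absIm R).
exists (a +i* b) => n; apply: (le_trans (normc_le_ReIm _)).
by rewrite mulr_natl mulr2n ReB ImB lerD.
Qed.

(** Periodicity is left out: the estimates of [mangoldt_sum] rest on complete multiplicativity, with
    [bounded_sums] as the source of cancellation. *)
Definition is_char (R : realType) (chi : nat -> R[i]) :=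
  [/\ chi 1%N = 1, {morph chi : m n / (m * n)%N >-> m * n} &
      forall n, normc (chi n) <= 1].

Definition bounded_sums (R : realType) (chi : nat -> R[i]) (B : R) :=
  forall N, normc (\sum_(1 <= n < N.+1) chi n) <= B.

Definition harmonic_sum (R : realType) (chi : nat -> R[i]) (x : nat) : R[i] :=
  \sum_(1 <= n < x.+1) chi n * (n%:R^-1)%:C.

Definition mangoldt_sum (R : realType) (chi : nat -> R[i]) (x : nat) : R[i] :=
  \sum_(1 <= n < x.+1) chi n * (mangoldt R n / n%:R)%:C.

Lemma abel_bound (R : realType) (chi : nat -> R[i]) (B : R) (a : nat -> R) M N :
  bounded_sums chi B ->
  (forall n, (0 < n)%N -> 0 <= a n.+1 <= a n) -> (M <= N)%N ->
  normc (\sum_(M.+1 <= n < N.+1) chi n * (a n)%:C) <= 2 * B * a M.+1.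
Proof.
move=> chiB adec /subnK <-; move: (N - M)%N => k.
pose A n := \sum_(1 <= i < n.+1) chi i.
have B0 : 0 <= B := le_trans (normc_ge0 _) (chiB 0%N).
have a0 n : (0 < n)%N -> 0 <= a n by move=> /adec/andP[]; exact: le_trans.
have adecS n : (0 < n)%N -> a n.+1 <= a n by move=> /adec/andP[].
have norm0 (y z : R[i]) : y - z = 0 -> y = z by move/eqP; rewrite subr_eq0 => /eqP.
(* Summation by parts: once both boundary terms are moved to the left, the remainder telescopes and
   the claim extends by one term at a time. *)
have key : normc (\sum_(M.+1 <= n < (k + M).+1) chi n * (a n)%:C
    - A (k + M)%N * (a (k + M).+1)%:C + A M * (a M.+1)%:C)
    <= B * (a M.+1 - a (k + M).+1).
  elim: k => [|k IH]; first by rewrite add0n big_geq // sub0r addNr Normc.normc0 subrr mulr0.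
  rewrite addSn big_nat_recr ?ltnS ?leq_addl //=.
  have AE : A (k + M).+1 = A (k + M)%N + chi (k + M).+1 by rewrite /A big_nat_recr.
  set m := (k + M)%N in IH AE *.
  set S := \sum_(_ <= _ < _) _ in IH *.
  have -> : S + chi m.+1 * (a m.+1)%:C - A m.+1 * (a m.+2)%:C + A M * (a M.+1)%:C
    = (S - A m * (a m.+1)%:C + A M * (a M.+1)%:C) + A m.+1 * (a m.+1 - a m.+2)%:C.
    by rewrite AE rmorphB /=; ring.
  apply: (le_trans (normc_add _ _)); rewrite Normc.normcM normc_real.
  have : normc (A m.+1) * `|a m.+1 - a m.+2| <= B * (a m.+1 - a m.+2).
    rewrite ger0_norm ?subr_ge0 ?adecS // ler_wpM2r ?subr_ge0 ?adecS //.
    exact: chiB.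
  move: IH; rewrite /m; lra.
set S := \sum_(_ <= _ < _) _ in key *.
have -> : S = (S - A (k + M)%N * (a (k + M).+1)%:C + A M * (a M.+1)%:C)
   + A (k + M)%N * (a (k + M).+1)%:C + - (A M * (a M.+1)%:C) by ring.
apply: (le_trans (normc_add _ _)); rewrite normc_opp.
apply: (@le_trans _ _ (B * (a M.+1 - a (k + M).+1) + B * a (k + M).+1 + B * a M.+1)).
  apply: lerD; first (apply: (le_trans (normc_add _ _)); apply: lerD => //).
    by rewrite Normc.normcM normc_real ger0_norm ?a0 // ler_wpM2r ?a0 //; exact: chiB.
  by rewrite Normc.normcM normc_real ger0_norm ?a0 // ler_wpM2r ?a0 //; exact: chiB.
by rewrite le_eqVlt; apply/orP; left; apply/eqP; ring.
Qed.

Lemma char_limit (R : realType) (chi : nat -> R[i]) (B : R) :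
  bounded_sums chi B ->
  exists l, forall N, normc (harmonic_sum chi N - l) <= 4 * B / N.+1%:R.
Proof.
move=> chiB.
have B0 : 0 <= B := le_trans (normc_ge0 _) (chiB 0%N).
have [|n|l hl] := @exists_nested_complex R (harmonic_sum chi) (fun n => 2 * B / n.+1%:R).
- move=> m n nm.
  have -> : harmonic_sum chi m - harmonic_sum chi n =
      \sum_(n.+1 <= i < m.+1) chi i * (i%:R^-1)%:C.
    rewrite /harmonic_sum [X in X - _](big_cat_nat _ (n := n.+1)) //=.
    by rewrite addrAC subrr add0r.
  apply: (abel_bound (a := fun n => n%:R^-1) chiB) => // i i0.
  by rewrite invr_ge0 ler0n /= lef_pV2 ?posrE ?ltr0n // ler_nat.
- by rewrite divr_ge0 // mulr_ge0.
exists l => N; apply: (le_trans (hl N)).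
by rewrite !mulrA -natrM.
Qed.

(* Unlike [ln t / t], the function [(1 + ln t) / t] decreases on all of [t >= 1]. *)
Lemma oneDln_div_decr (R : realType) n : (0 < n)%N ->
  ln n%:R / (n%:R * n.+1%:R) <=
  (1 + ln n%:R) / n%:R - (1 + ln n.+1%:R) / n.+1%:R :> R.
Proof.
move=> n0; have nR : 0 < n%:R :> R by rewrite ltr0n.
have E : ln (n.+1%:R : R) = ln n%:R + ln (1 + n%:R^-1).
  rewrite -lnM ?posrE ?addr_gt0 ?invr_gt0 // mulrDr mulr1 divff ?gt_eqF //.
  by rewrite -natr1.
have H : n%:R * ln (1 + n%:R^-1) <= 1 :> R.
  rewrite -ler_pdivlMl // mulr1 le_ln1Dx // (lt_trans (_ : -1 < 0)) ?invr_gt0 //; lra.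
have S1 : n.+1%:R = n%:R + 1 :> R by rewrite natr1.
have -> : (1 + ln n%:R) / n%:R - (1 + ln n.+1%:R) / n.+1%:R =
   (1 + ln n%:R - n%:R * ln (1 + n%:R^-1)) / (n%:R * n.+1%:R) :> R.
  by rewrite E S1; field; rewrite !gt_eqF // addr_gt0.
rewrite ler_pM2r ?invr_gt0 ?mulr_gt0 ?ltr0n //; lra.
Qed.

(** Writing [ln n / n] as [(1 + ln n) / n - 1 / n] gives two decreasing weights, both equal to 1 at
    [n = 1]; each costs [2 * B]. *)
Lemma char_ln_sum_bounded (R : realType) (chi : nat -> R[i]) (B : R) x :
  bounded_sums chi B ->
  normc (\sum_(1 <= n < x.+1) chi n * (ln n%:R / n%:R)%:C) <= 4 * B.
Proof.
move=> chiB.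
have -> : \sum_(1 <= n < x.+1) chi n * (ln n%:R / n%:R)%:C =
   \sum_(1 <= n < x.+1) chi n * ((1 + ln n%:R) / n%:R)%:C
   - \sum_(1 <= n < x.+1) chi n * (n%:R^-1)%:C.
  rewrite -sumrB; apply: eq_bigr => n _; rewrite -mulrBr -rmorphB /=.
  by congr (_ * _%:C); rewrite mulrDl mul1r addrAC subrr add0r.
apply: (le_trans (normc_add _ _)); rewrite normc_opp.
have := @abel_bound _ chi B (fun n => (1 + ln n%:R) / n%:R) 0 x chiB.
have := @abel_bound _ chi B (fun n => n%:R^-1) 0 x chiB.
rewrite /= ln1 invr1 addr0 !mulr1 => h1 h2.
have {}h1 := h1 _ (leq0n _).
have {}h2 := h2 _ (leq0n _).
rewrite (_ : 4 * B = 2 * B + 2 * B); last by ring.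
apply: lerD.
  apply: h2 => n n0; apply/andP; split.
    by rewrite divr_ge0 // addr_ge0 // ln_ge0 // ler1n.
  rewrite -subr_ge0; apply: le_trans (oneDln_div_decr _ n0).
  by rewrite divr_ge0 ?mulr_ge0 // ln_ge0 // ler1n.
apply: h1 => n n0; by rewrite invr_ge0 ler0n /= lef_pV2 ?posrE ?ltr0n // ler_nat.
Qed.

(** A tail of the series beyond [x / d], of order [1 / (x %/ d).+1], carries the weight [1 / d]; the
    product is at most [1 / x] uniformly in [d]. *)
Lemma floor_quot_bound (R : realType) x d : (0 < d)%N -> (0 < x)%N ->
  (d%:R * (x %/ d).+1%:R)^-1 <= x%:R^-1 :> R.
Proof.
move=> d0 x0; rewrite lef_pV2 ?posrE ?mulr_gt0 ?ltr0n // -natrM ler_nat.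
by rewrite mulnC ltnW // {1}(divn_eq x d) mulSn addnC ltn_add2r ltn_pmod.
Qed.

(* Multiplying the hyperbola identity [ln = mangoldt * 1] by [chi n / n] gives
   [L * mangoldt_sum chi x] up to the tails of the series [L]. *)
Lemma mangoldt_sum_bounded (R : realType) (chi : nat -> R[i]) (B K : R) (l : R[i]) :
  is_char chi -> bounded_sums chi B -> l != 0 ->
  (forall N, normc (harmonic_sum chi N - l) <= K / N.+1%:R) ->
  exists C, forall x, normc (mangoldt_sum chi x) <= C.
Proof.
move=> [chi1 chiM chi_le1] chiB l0 hl.
have nl : 0 < normc l.
  by rewrite lt_def normc_ge0 andbT; apply: contraNneq l0 => /Normc.eq0_normc ->.
exists ((4 * B + 4 * K) / normc l) => x.
have K0 : 0 <= K by have := le_trans (normc_ge0 _) (hl 0%N); rewrite divr1.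
have B0 : 0 <= B := le_trans (normc_ge0 _) (chiB 0%N).
have [->|x0] := posnP x.
  by rewrite /mangoldt_sum big_geq // Normc.normc0 divr_ge0 ?(ltW nl) // addr_ge0 // mulr_ge0.
rewrite ler_pdivlMr // -Normc.normcM.
have E : \sum_(1 <= n < x.+1) chi n * (ln n%:R / n%:R)%:C =
   \sum_(1 <= d < x.+1) chi d * (mangoldt R d / d%:R)%:C * harmonic_sum chi (x %/ d).
  transitivity (\sum_(1 <= n < x.+1) \sum_(1 <= d < n.+1 | (d %| n)%N)
      (chi d * (mangoldt R d / d%:R)%:C * (chi (n %/ d)%N * ((n %/ d)%N%:R^-1)%:C))).
    apply: eq_big_nat => n /andP[n1 _].
    rewrite -sum_mangoldt_divisors // mulr_suml rmorph_sum mulr_sumr /= big_nat_cond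
      [RHS]big_nat_cond; apply: eq_bigr => d /andP[/andP[d1 _] dn].
    rewrite mulrACA -chiM -rmorphM /= [(d * _)%N]mulnC divnK //; congr (_ * _%:C).
    by rewrite -[in LHS](divnK dn) natrM invfM mulrA mulrAC.
  rewrite -(sum_hyperbola x (fun d m =>
     chi d * (mangoldt R d / d%:R)%:C * (chi m * (m%:R^-1)%:C))).
  by apply: eq_bigr => d _; rewrite -mulr_sumr.
have -> : mangoldt_sum chi x * l = \sum_(1 <= n < x.+1) chi n * (ln n%:R / n%:R)%:C
   - \sum_(1 <= d < x.+1) chi d * (mangoldt R d / d%:R)%:C * (harmonic_sum chi (x %/ d) - l).
  rewrite E -sumrB /mangoldt_sum mulr_suml; apply: eq_bigr => d _; ring.
apply: (le_trans (normc_add _ _)); rewrite normc_opp; apply: lerD.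
  exact: char_ln_sum_bounded.
apply: (le_trans (normc_sum _ _ _)).
have xR : 0 < x%:R :> R by rewrite ltr0n.
(* The tails add up to [K / x] times the sum of [mangoldt], which Chebyshev's estimate bounds by
   [4 * K]. *)
apply: (@le_trans _ _ (\sum_(1 <= d < x.+1) mangoldt R d * (K / x%:R))).
  apply: ler_sum_nat => d /andP[d1 _].
  rewrite !Normc.normcM normc_real ger0_norm ?divr_ge0 ?mangoldt_ge0 //.
  apply: (@le_trans _ _ (1 * (mangoldt R d / d%:R) * (K / (x %/ d).+1%:R))).
    by rewrite ler_pM ?mulr_ge0 ?normc_ge0 ?invr_ge0 ?mangoldt_ge0 // ler_wpM2r
      ?mulr_ge0 ?invr_ge0 ?mangoldt_ge0.
  rewrite mul1r -mulrA ler_wpM2l ?mangoldt_ge0 // mulrCA ler_wpM2l // -invfM.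
  exact: floor_quot_bound.
rewrite -mulr_suml mulrCA [4 * K]mulrC ler_wpM2l // ler_pdivrMr //.
exact: chebyshev_psi.
Qed.

(* When the series vanishes, [H d := ln (x / d) + mangoldt_sum chi (x / d)] has
   small Dirichlet convolution with [chi n / n]; Moebius inversion recovers [H 1]. *)
Lemma mangoldt_sum_vanishing (R : realType) (chi : nat -> R[i]) (K : R) :
  is_char chi ->
  (forall N, normc (harmonic_sum chi N) <= K / N.+1%:R) ->
  forall x, (0 < x)%N -> normc (mangoldt_sum chi x + (ln x%:R)%:C) <= K.
Proof.
move=> [chi1 chiM chi_le1] hl x x0.
have xR : 0 < x%:R :> R by rewrite ltr0n.
have K0 : 0 <= K by have := le_trans (normc_ge0 _) (hl 0%N); rewrite divr1.
pose H d := (ln x%:R - ln d%:R)%:C + mangoldt_sum chi (x %/ d).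
(* In the convolution over [m] the [mangoldt] part sums to [ln m], which cancels the [- ln m] of
   [ln (x / (d * m))] and leaves the factor [ln (x / d)]. *)
have QE d : (0 < d)%N ->
    \sum_(1 <= m < (x %/ d).+1) chi m * (m%:R^-1)%:C * H (d * m)%N =
    (ln x%:R - ln d%:R)%:C * harmonic_sum chi (x %/ d).
  move=> d0; set y := (x %/ d)%N.
  have E2 : \sum_(1 <= m < y.+1) chi m * (m%:R^-1)%:C * mangoldt_sum chi (y %/ m) =
      \sum_(1 <= n < y.+1) chi n * (ln n%:R / n%:R)%:C.
    transitivity (\sum_(1 <= m < y.+1) \sum_(1 <= e < (y %/ m).+1)
       chi m * (m%:R^-1)%:C * (chi e * (mangoldt R e / e%:R)%:C)).
      by apply: eq_bigr => m _; rewrite mulr_sumr.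
    rewrite sum_hyperbola_swap sum_hyperbola; apply: eq_big_nat => n /andP[n1 _].
    rewrite -sum_mangoldt_divisors // mulr_suml rmorph_sum mulr_sumr /= big_nat_cond
      [RHS]big_nat_cond; apply: eq_bigr => e /andP[/andP[e1 _] en].
    rewrite mulrACA -chiM -rmorphM /= divnK //; congr (_ * _%:C).
    by rewrite -[in RHS](divnK en) natrM invfM mulrCA.
  rewrite /harmonic_sum mulr_sumr.
  transitivity (\sum_(1 <= m < y.+1)
     (chi m * (m%:R^-1)%:C * (ln x%:R - ln d%:R - ln m%:R)%:C) +
     \sum_(1 <= m < y.+1) chi m * (m%:R^-1)%:C * mangoldt_sum chi (y %/ m)).
    rewrite -big_split /=; apply: eq_big_nat => m /andP[m1 _].
    rewrite -mulrDr /H natrM lnM ?posrE ?ltr0n // divnMA -/y opprD addrA //.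
  rewrite E2 -big_split /=; apply: eq_bigr => m _.
  by rewrite !rmorphB rmorphM /=; ring.
have inv : \sum_(1 <= d < x.+1) (moebius d)%:~R * (chi d * (d%:R^-1)%:C) *
     ((ln x%:R - ln d%:R)%:C * harmonic_sum chi (x %/ d)) = H 1%N.
  transitivity (\sum_(1 <= d < x.+1) \sum_(1 <= m < (x %/ d).+1)
      (moebius d)%:~R * (chi (d * m)%N * ((d * m)%N%:R^-1)%:C * H (d * m)%N)).
    apply: eq_big_nat => d /andP[d1 _]; rewrite -QE // mulr_sumr.
    apply: eq_bigr => m _; rewrite chiM natrM invfM rmorphM /=; ring.
  rewrite sum_hyperbola.
  transitivity (\sum_(1 <= n < x.+1) (if n == 1%N then H 1%N else 0)); last first.
    rewrite big_nat_recl //= big_nat_cond big1 ?addr0 // => i /andP[/andP[i0 _] _].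
    by case: i i0.
  apply: eq_big_nat => n /andP[n1 _].
  transitivity ((\sum_(1 <= d < n.+1 | (d %| n)%N) moebius d)%:~R *
     (chi n * (n%:R^-1)%:C * H n)).
    rewrite rmorph_sum mulr_suml /=; apply: eq_bigr => d dn.
    by rewrite mulnC divnK.
  case: eqP => [->|/eqP n1'].
    by rewrite big_mkcond big_nat1 /= moebius1 chi1 invr1 !mul1r.
  by rewrite sum_moebius ?mul0r // ltn_neqAle eq_sym n1' n1.
have -> : mangoldt_sum chi x + (ln x%:R)%:C = H 1%N.
  by rewrite /H ln1 subr0 divn1 addrC.
rewrite -inv; apply: (le_trans (normc_sum _ _ _)).
(* No logarithm is lost here: by Stirling, [ln x - ln d] summed over [d <= x] is at most [x]. *)
apply: (@le_trans _ _ (\sum_(1 <= d < x.+1) (ln x%:R - ln d%:R) * (K / x%:R))).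
  apply: ler_sum_nat => d /andP[d1 dx].
  have lnd : 0 <= ln x%:R - ln d%:R :> R.
    by rewrite subr_ge0 ler_ln ?posrE ?ltr0n ?ler_nat.
  have dR : 0 < d%:R :> R by rewrite ltr0n.
  rewrite !Normc.normcM !normc_real !ger0_norm ?invr_ge0 //.
  have -> : normc ((moebius d)%:~R : R[i]) = `|(moebius d)%:~R|.
    by rewrite -(rmorph_int (real_complex R)) normc_real.
  have mu1 : `|(moebius d)%:~R| <= 1 :> R.
    by rewrite -intr_norm -[1]/(1%:~R) ler_int norm_moebius.
  apply: (@le_trans _ _ (1 * (1 * d%:R^-1) *
      ((ln x%:R - ln d%:R) * (K / (x %/ d).+1%:R)))).
    rewrite ler_pM ?mulr_ge0 ?normc_ge0 ?invr_ge0 //.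
      by rewrite ler_pM ?mulr_ge0 ?normc_ge0 ?invr_ge0 // ler_wpM2r ?invr_ge0.
    by rewrite ler_wpM2l.
  rewrite !mul1r mulrCA ler_wpM2l // mulrCA ler_wpM2l // -invfM.
  exact: floor_quot_bound.
rewrite -mulr_suml mulrA ler_pdivrMr // mulrC ler_wpM2l // sumrB.
rewrite sumr_const_nat subSS subn0 -[_ *+ x]mulr_natl; have := sum_ln_ge R x; lra.
Qed.

Lemma natr_unbounded (R : realType) (M : R) : exists n : nat, M < n%:R.
Proof. by exists (Num.bound `|M|); apply: (le_lt_trans (ler_norm M)); exact: archi_boundP. Qed.

Lemma ln_unbounded (R : realType) (M : R) :
  exists2 x : nat, (0 < x)%N & M < ln x%:R.
Proof.
have [n hn] := natr_unbounded (expR M).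
have n0 : 0 < n%:R :> R := lt_trans (expR_gt0 _) hn.
exists n; first by rewrite ltr0n in n0.
by rewrite -(expRK M) ltr_ln // posrE expR_gt0.
Qed.

(** * Nonvanishing of the series for nonreal characters *)

Lemma ReD (R : rcfType) (y z : R[i]) : Re (y + z) = Re y + Re z.
Proof. by case: y z => [a b] [c d]. Qed.

Lemma Re_sum (R : rcfType) I (r : seq I) (P : pred I) (F : I -> R[i]) :
  Re (\sum_(i <- r | P i) F i) = \sum_(i <- r | P i) Re (F i).
Proof.
apply: (big_ind2 (fun (z : R[i]) a => Re z = a)) => //.
by move=> [a b] _ [c d] _ <- <-.
Qed.

Lemma Re_mulr (R : rcfType) (z : R[i]) (a : R) : Re (z * a%:C) = Re z * a.
Proof. by case: z => b c /=; rewrite mulr0 subr0. Qed.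

Lemma is_char_sqr (R : realType) (chi : nat -> R[i]) :
  is_char chi -> is_char (fun n => chi n ^+ 2).
Proof.
case=> chi1 chiM chi_le1; split; first by rewrite chi1 expr1n.
  by move=> m n; rewrite chiM exprMn.
by move=> n; rewrite expr2 Normc.normcM mulr_ile1 ?normc_ge0.
Qed.

(** If the series vanishes, the real part is [- ln x + O(1)], so an upper bound holds in either
    case. It serves for the square of a character, whose own series is then allowed to vanish. *)
Lemma mangoldt_sum_Re_le (R : realType) (chi : nat -> R[i]) (B : R) :
  is_char chi -> bounded_sums chi B ->
  exists C, forall x, (0 < x)%N -> Re (mangoldt_sum chi x) <= C.
Proof.
move=> chic chiB; have [l hl] := char_limit chiB.
have [l0|l0] := eqVneq l 0; last first.
  have [C hC] := mangoldt_sum_bounded chic chiB l0 hl.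
  exists C => x _; apply: le_trans (hC x); apply: le_trans (normc_ge_absRe _).
  exact: ler_norm.
exists (4 * B) => x x0.
have := @mangoldt_sum_vanishing _ chi (4 * B) chic _ x x0.
have /[swap] /[apply] h : forall N, normc (harmonic_sum chi N) <= 4 * B / N.+1%:R.
  by move=> N; have := hl N; rewrite l0 subr0.
have : Re (mangoldt_sum chi x + (ln x%:R)%:C) <= 4 * B.
  apply: le_trans h; apply: le_trans (normc_ge_absRe _); exact: ler_norm.
have : 0 <= ln x%:R :> R by rewrite ln_ge0 // ler1n.
case: (mangoldt_sum chi x) => a b /=; lra.
Qed.

(* If [L = 0], then summing [3 + 4 Re chi + Re chi^2 >= 0] against [mangoldt n / n]
   would give [0 <= (3 - 4) ln x + O(1)]. *)
Lemma mangoldt_sum_char_nonreal (R : realType) (chi : nat -> R[i]) (B B' : R) :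
  is_char chi -> bounded_sums chi B -> bounded_sums (fun n => chi n ^+ 2) B' ->
  exists C, forall x, normc (mangoldt_sum chi x) <= C.
Proof.
move=> chic chiB chi2B; have [l hl] := char_limit chiB.
have [l0|l0] := eqVneq l 0; last exact: (mangoldt_sum_bounded chic chiB l0 hl).
have [C2 hC2] := mangoldt_sum_Re_le (is_char_sqr chic) chi2B.
have h0 N : normc (harmonic_sum chi N) <= 4 * B / N.+1%:R.
  by have := hl N; rewrite l0 subr0.
(* The constants collect the errors: Mertens' 4 with coefficient 3, [4 * B] for [chi] with
   coefficient 4, and [C2] for its square. *)
have [x x0 hx] := ln_unbounded (3 * 4 + 4 * (4 * B) + C2 : R).
have := mangoldt_sum_vanishing chic h0 x0.
have := hC2 x x0.
have /andP[_] := mertens_mangoldt R x0.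
move=> h1 h2 h3.
have h4 : Re (mangoldt_sum chi x) <= 4 * B - ln x%:R.
  have : Re (mangoldt_sum chi x + (ln x%:R)%:C) <= 4 * B.
    apply: le_trans h3; apply: le_trans (normc_ge_absRe _); exact: ler_norm.
  case: (mangoldt_sum chi x) => a b /=; lra.
have : 0 <= 3 * (\sum_(1 <= n < x.+1) mangoldt R n / n%:R) + 4 * Re (mangoldt_sum chi x)
    + Re (mangoldt_sum (fun n => chi n ^+ 2) x).
  rewrite /mangoldt_sum !Re_sum !mulr_sumr -!big_split /= sumr_ge0 // => n _.
  rewrite !Re_mulr.
  have -> : forall u v w : R, 3 * u + 4 * (v * u) + w * u = u * (3 + 4 * v + w).
    by move=> *; ring.
  rewrite mulr_ge0 ?divr_ge0 ?mangoldt_ge0 //.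
  have [_ _ /(_ n)] := chic.
  (* On the closed unit disc, which includes the value 0 of [chi],
     [3 + 4 a + a^2 - b^2 >= 2 (a + 1)^2]. *)
  case: (chi n) => a b /= ab; 
  have : a ^+ 2 + b ^+ 2 <= 1.
    by rewrite -ler_sqrt // sqrtr1.
  have : 0 <= (a + 1) ^+ 2 by exact: sqr_ge0.
  rewrite !expr2; lra.
move: hx h1 h2 h4; lra.
Qed.

(** Multiplication by [a] permutes the residues, so the sum [S] over a period satisfies
    [chi a * S = S] and vanishes; at most one period remains. *)
Lemma periodic_bounded_sums (R : realType) (chi : nat -> R[i]) q a :
  is_char chi -> (0 < q)%N -> (forall n, chi (n + q)%N = chi n) -> coprime a q ->
  chi a != 1 -> bounded_sums chi q%:R.
Proof.
move=> [chi1 chiM chi_le1] q0 per aq a1.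
have permod n : chi (n %% q)%N = chi n.
  rewrite [in RHS](divn_eq n q); elim: (n %/ q)%N => [|k IH] //.
  by rewrite mulSn -addnA [(q + _)%N]addnC per.
(* This lets the sums start at 0, so that whole periods can be cut off. *)
have chi0 : chi 0%N = 0.
  have : chi 0%N * (chi a - 1) = 0 by rewrite mulrBr mulr1 -chiM mul0n subrr.
  by move/eqP; rewrite mulf_eq0 subr_eq0 (negbTE a1) orbF => /eqP.
have S0 : \sum_(0 <= n < q) chi n = 0.
  rewrite big_mkord; set S := \sum_(_ < _) _.
  have inj : injective (fun i : 'I_q => Ordinal (ltn_pmod (a * i) q0)).
    move=> i k /(congr1 val) /= /eqP ik; apply: val_inj => /=.
    wlog ki : i k ik / (k <= i)%N.
      by move=> W; case/orP: (leq_total k i) => [/W|/W] -> //; rewrite eq_sym.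
    move: ik; rewrite eqn_mod_dvd ?leq_mul // -mulnBr Gauss_dvdr 1?coprime_sym //.
    have [//|ne] := eqVneq (i : nat) k.
    by move/dvdn_leq; have := ltn_ord i; lia.
  have : chi a * S = S.
    rewrite mulr_sumr [RHS](reindex_inj inj); apply: eq_bigr => i _ /=.
    by rewrite -chiM permod.
  move/eqP; rewrite -subr_eq0 -[X in _ - X]mul1r -mulrBl mulf_eq0 subr_eq0 (negbTE a1).
  by move/eqP.
move=> N; have -> : \sum_(1 <= n < N.+1) chi n = \sum_(0 <= n < N.+1) chi n.
  by rewrite [RHS]big_ltn // chi0 add0r.
elim/ltn_ind: (N.+1) => m IH.
have [mq|qm] := leqP m q.
  apply: (le_trans (normc_sum _ _ _)).
  apply: (@le_trans _ _ (\sum_(0 <= n < m) 1)).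
    by apply: ler_sum_nat => n _; exact: chi_le1.
  by rewrite sumr_const_nat subn0 ler_nat.
rewrite (big_cat_nat _ (n := q)) //=; last exact: ltnW.
rewrite S0 add0r -[X in \sum_(X <= _ < _) _]add0n big_addn.
rewrite (eq_bigr chi) ?IH //; lia.
Qed.

(** The sign patterns are those of the real characters of discriminants -4, 8 and -8. The sums stop
    at [8 * N + 7], the end of a block of residues 1, 3, 5, 7: the first block is at least 1/2 and
    each later one is nonnegative, which a limit 0 would contradict. *)
Lemma harmonic_sum_real_mod8 (R : realType) (chi : nat -> R[i]) (l : R[i]) (K : R) :
  (forall n, chi (n + 8)%N = chi n) -> (forall n, ~~ odd n -> chi n = 0) ->
  chi 1%N = 1 ->
  [\/ [/\ chi 3%N = -1, chi 5%N = 1 & chi 7%N = -1],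
      [/\ chi 3%N = -1, chi 5%N = -1 & chi 7%N = 1] |
      [/\ chi 3%N = 1, chi 5%N = -1 & chi 7%N = -1]] ->
  (forall N, normc (harmonic_sum chi N - l) <= K / N.+1%:R) -> l != 0.
Proof.
move=> per even0 chi1 pat hl; apply/eqP => l0.
pose h N := Re (harmonic_sum chi (8 * N + 7)).
have hE n : (8 <= n)%N -> chi n = chi (n - 8)%N by move=> n8; rewrite -{1}(subnK n8) per.
have perN N r : chi (8 * N + r)%N = chi r.
  by elim: N => [|N IH] //; rewrite mulnS -addnA addnC per IH.
have h_ge N : 1 / 2 <= h N.
  have step M : h M.+1 = h M + Re (chi 1%N) / (M * 8 + 9)%:R + Re (chi 3%N) / (M * 8 + 11)%:R
     + Re (chi 5%N) / (M * 8 + 13)%:R + Re (chi 7%N) / (M * 8 + 15)%:R.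
    rewrite /h (_ : 8 * M.+1 + 7 = 8 * M + 15)%N; last lia.
    rewrite /harmonic_sum (big_cat_nat _ (n := (8 * M + 7).+1)) //=; last lia.
    have -> : \sum_((8 * M + 7).+1 <= n < (8 * M + 15).+1) chi n * (n%:R^-1)%:C =
      \sum_(8 <= r < 16) chi r * ((8 * M + r)%:R^-1)%:C.
      rewrite -addnS -[(_ + 15).+1]addnS -!(addnC _ (8 * M)%N) big_addn addnK.
      by apply: eq_bigr => r _; rewrite addnC perN.
    set S := \sum_(1 <= _ < _) _; rewrite unlock /= (hE 8%N) // (hE 9%N) // (hE 10%N) //
      (hE 11%N) // (hE 12%N) // (hE 13%N) // (hE 14%N) // (hE 15%N) // !subSS !subn0.
    rewrite (even0 0%N) // (even0 2%N) // (even0 4%N) // (even0 6%N) // !mul0r !add0r !addr0.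
    rewrite -!Re_mulr !ReD (mulnC M); ring.
  elim: N => [|M IH].
    rewrite /h /harmonic_sum unlock /= (even0 2%N) // (even0 4%N) // (even0 6%N) //.
    rewrite !mul0r !add0r !addr0 !ReD !Re_mulr chi1.
    case: pat => -[-> -> ->] /=; lra.
  apply: (le_trans IH); rewrite step -!addrA lerDl !addrA.
  have t (a b : nat) : (a <= b)%N -> (0 < a)%N -> b%:R^-1 <= a%:R^-1 :> R.
    by move=> ab a0; rewrite lef_pV2 ?posrE ?ltr0n ?ler_nat //; lia.
  have t1 := t (M * 8 + 9)%N (M * 8 + 11)%N.
  have t2 := t (M * 8 + 13)%N (M * 8 + 15)%N.
  have t3 := t (M * 8 + 11)%N (M * 8 + 15)%N.
  have t4 := t (M * 8 + 9)%N (M * 8 + 13)%N.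
  have {}t1 : (M * 8 + 11)%:R^-1 <= (M * 8 + 9)%:R^-1 :> R by apply: t1; lia.
  have {}t2 : (M * 8 + 15)%:R^-1 <= (M * 8 + 13)%:R^-1 :> R by apply: t2; lia.
  have {}t3 : (M * 8 + 15)%:R^-1 <= (M * 8 + 11)%:R^-1 :> R by apply: t3; lia.
  have {}t4 : (M * 8 + 13)%:R^-1 <= (M * 8 + 9)%:R^-1 :> R by apply: t4; lia.
  (* The pattern [+ - - +] needs convexity of [1 / t]; the other two need only its monotonicity. *)
  have t5 : 0 <= (M * 8 + 9)%:R^-1 - (M * 8 + 11)%:R^-1
      - (M * 8 + 13)%:R^-1 + (M * 8 + 15)%:R^-1 :> R.
    have M0 : 0 <= (M * 8)%:R :> R by [].
    rewrite !natrD; set u := (M * 8)%:R in M0 *.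
    have -> : (u + 9)^-1 - (u + 11)^-1 - (u + 13)^-1 + (u + 15)^-1 =
       (2 * ((u + 13) * (u + 15) - (u + 9) * (u + 11))) /
         ((u + 9) * (u + 11) * (u + 13) * (u + 15)) by field; clear -M0; lra.
    by rewrite divr_ge0 //; last (by rewrite !mulr_ge0 ?addr_ge0); clear -M0; nra.
  rewrite chi1; case: pat => -[-> -> ->] /=; lra.
have [N hN] := natr_unbounded (2 * K).
have := hl (8 * N + 7)%N; rewrite l0 subr0 => h1.
have h2 : 1 / 2 <= normc (harmonic_sum chi (8 * N + 7)).
  by apply: le_trans (h_ge N) _; apply: le_trans (normc_ge_absRe _); exact: ler_norm.
have : 1 / 2 <= K / (8 * N + 7).+1%:R := le_trans h2 h1.
rewrite ler_pdivlMr ?ltr0n //.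
have : N%:R <= (8 * N + 7).+1%:R :> R by rewrite ler_nat; lia.
lra.
Qed.

(** * Characters modulo powers of two *)

Lemma dvdz_addr d m n : (d %| m)%Z -> (d %| m + n)%Z = (d %| n)%Z.
Proof. by move=> dm; exact: (rpredDl n dm). Qed.

Lemma dvdz_add d m n : (d %| m)%Z -> (d %| n)%Z -> (d %| m + n)%Z.
Proof. by move=> dm; rewrite dvdz_addr. Qed.

Lemma dvdz_opp d m : (d %| - m)%Z = (d %| m)%Z.
Proof. by rewrite !dvdzE abszN. Qed.

Lemma oddzP (m : int) : ~~ (2 %| m)%Z -> exists a, m = 2 * a + 1.
Proof. by move=> m2; exists ((m - 1) %/ 2)%Z; lia. Qed.

(** On odd [n] this is the nontrivial character modulo 4. It is the sign that makes [n * sgn4 n]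
    equal to 1 modulo 4, hence a power of 5 modulo every power of 2. *)
Definition sgn4 (n : nat) : int := if (n %% 4 == 1)%N then 1 else -1.

Lemma sgn4M m n : odd m -> odd n -> sgn4 (m * n) = sgn4 m * sgn4 n.
Proof.
have odd4 k : odd k -> (k %% 4 = 1 \/ k %% 4 = 3)%N by lia.
rewrite /sgn4 -modnMm => /odd4[] -> /odd4[] -> //=.
Qed.

Lemma sgn4_sqr n : sgn4 n ^+ 2 = 1.
Proof. by rewrite /sgn4; case: ifP. Qed.

Lemma dvd4_mul_sgn4 n : odd n -> (4 %| n%:Z * sgn4 n - 1)%Z.
Proof. by rewrite /sgn4; case: ifP; lia. Qed.

(** Each squaring gains exactly one factor 2; the odd cofactor [u] records that it gains no more,
    which fixes the order of 5 modulo powers of 2. *)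
Lemma expr5_expn2 j :
  exists2 u : int, (5 : int) ^+ (2 ^ j) = 1 + 2 ^+ j.+2 * u & ~~ (2 %| u)%Z.
Proof.
elim: j => [|j [u E u2]]; first by exists 1.
exists (u + 2 ^+ j.+1 * u ^+ 2).
  rewrite expnSr exprM E !exprS; ring.
rewrite dvdzE in u2 *; rewrite exprS; lia.
Qed.

Lemma dvdz_expr5_subr1 j d :
  (2 ^+ j.+2 %| (5 : int) ^+ d - 1)%Z = (2 ^ j %| d)%N.
Proof.
have sub (y : int) e : (y - 1 %| y ^+ e - 1)%Z.
  by rewrite subrX1 dvdz_mulr.
apply/idP/idP; last first.
  case/dvdnP => e ->; rewrite mulnC exprM; apply: dvdz_trans (sub _ _).
  by have [u -> _] := expr5_expn2 j; rewrite addrAC subrr add0r dvdz_mulr.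
elim: j => [|j IH] dv; first by rewrite expn0 dvd1n.
have /dvdnP[e de] : (2 ^ j %| d)%N.
  by apply: IH; apply: dvdz_trans dv; rewrite [in X in (_ %| X)%Z]exprS dvdz_mull.
have [e2|e2] := boolP (2 %| e)%N; first by rewrite de expnS dvdn_mul.
have [u E u2] := expr5_expn2 j.
have [f ef] : exists f, e = (2 * f).+1 by exists e./2; lia.
(* For odd [e], [y ^ (2 f)] is 1 modulo [2 ^ j.+3], so there [5 ^ d - 1] reduces to [2 ^ j.+2 * u]
   with [u] odd. *)
move: dv; rewrite de mulnC exprM E ef [_ ^+ (2 * f).+1]exprS; set y := 1 + _.
have ysq : (2 ^+ j.+3 %| y ^+ (2 * f) - 1)%Z.
  rewrite exprM; apply: dvdz_trans (sub _ _).
  have -> : y ^+ 2 - 1 = 2 ^+ j.+3 * (u + 2 ^+ j.+1 * u ^+ 2).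
    by rewrite /y !exprS; ring.
  exact: dvdz_mulr.
rewrite (_ : y * y ^+ (2 * f) - 1 = y * (y ^+ (2 * f) - 1) + 2 ^+ j.+2 * u); last first.
  by rewrite /y; ring.
by rewrite (dvdz_addr _ (dvdz_mull _ ysq)) [_ ^+ j.+3]exprSr dvdz_mul2l ?(negbTE u2) ?expf_neq0.
Qed.

(** Lifting from [2 ^ j.+2] to [2 ^ j.+3]: if the quotient [t] is odd, adding [2 ^ j] to the
    exponent subtracts an odd multiple of [2 ^ j.+2] and repairs the parity. *)
Lemma exists_dlog j n : odd n ->
  exists b : nat, (2 ^+ j.+2 %| n%:Z * sgn4 n - 5 ^+ b)%Z.
Proof.
move=> on; elim: j => [|j [b hb]]; first by exists 0%N; exact: dvd4_mul_sgn4.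
have [u E u2] := expr5_expn2 j.
have /dvdzP[t ht] := hb.
have [t2|t2] := boolP (2 %| t)%Z.
  by exists b; rewrite ht exprS dvdz_mul.
exists (b + 2 ^ j)%N; rewrite exprD E.
have -> : n%:Z * sgn4 n - 5 ^+ b * (1 + 2 ^+ j.+2 * u) = (t - 5 ^+ b * u) * 2 ^+ j.+2.
  by rewrite mulrBl -ht; ring.
rewrite exprS dvdz_mul //.
have : ~~ (2 %| (5 : int) ^+ b)%Z by elim: (b) => [|k IH] //; rewrite exprS; lia.
move=> /oddzP[v ->]; have [[a ->] [c ->]] := (oddzP t2, oddzP u2).
apply/dvdzP; exists (a - 2 * v * c - v - c); ring.
Qed.

(** Only its class modulo [2 ^ j] is determined. Any representative serves, as it becomes the
    exponent of some [z] with [z ^+ (2 ^ j) = 1]. *)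
Definition dlog j n : nat :=
  xget 0%N [set b : nat | (2 ^+ j.+2 %| n%:Z * sgn4 n - 5 ^+ b)%Z].

Lemma dlogP j n : odd n -> (2 ^+ j.+2 %| n%:Z * sgn4 n - 5 ^+ (dlog j n))%Z.
Proof.
move=> /(exists_dlog j)[b hb].
pose A := [set b : nat | (2 ^+ j.+2 %| n%:Z * sgn4 n - 5 ^+ b)%Z].
by have : A (dlog j n) by apply: xgetPex; exists b.
Qed.

Lemma dvdz_expr5_sub j b c : (2 ^+ j.+2 %| (5 : int) ^+ b - 5 ^+ c)%Z ->
  b = c %[mod 2 ^ j].
Proof.
wlog bc : b c / (c <= b)%N.
  move=> W; case/orP: (leq_total c b) => [/W //|/W h].
  by rewrite -dvdz_opp opprB => /h.
rewrite -{1}(subnK bc) addnC exprD -[X in (_ - X)]mulr1 -mulrBr Gauss_dvdzr.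
  by rewrite dvdz_expr5_subr1 => h; apply/eqP; rewrite eqn_mod_dvd.
by rewrite coprimezXl // coprimezXr.
Qed.

Lemma expr_dlog (F : nzRingType) j (z : F) n c : z ^+ (2 ^ j) = 1 -> odd n ->
  (2 ^+ j.+2 %| n%:Z * sgn4 n - 5 ^+ c)%Z -> z ^+ dlog j n = z ^+ c.
Proof.
move=> zj on hc; rewrite -(expr_mod _ zj) -[RHS](expr_mod _ zj); congr (_ ^+ _).
apply: dvdz_expr5_sub.
have -> : 5 ^+ dlog j n - 5 ^+ c =
  (n%:Z * sgn4 n - 5 ^+ c) - (n%:Z * sgn4 n - 5 ^+ (dlog j n)) by ring.
by rewrite dvdz_add ?dvdz_opp ?dlogP.
Qed.

(* The characters modulo [2 ^ (j + 2)]: the unit group is generated by [-1] and [5]. *)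
Definition char2 (R : realType) j (e : bool) (z : R[i]) (n : nat) : R[i] :=
  if odd n then (if e then (sgn4 n)%:~R else 1) * z ^+ dlog j n else 0.

Lemma char2_odd (R : realType) j e (z : R[i]) n c : z ^+ (2 ^ j) = 1 -> odd n ->
  (2 ^+ j.+2 %| n%:Z * sgn4 n - 5 ^+ c)%Z ->
  char2 j e z n = (if e then (sgn4 n)%:~R else 1) * z ^+ c.
Proof. by move=> zj on hc; rewrite /char2 on (expr_dlog zj on hc). Qed.

Lemma char2_is_char (R : realType) j e (z : R[i]) : z ^+ (2 ^ j) = 1 ->
  is_char (char2 j e z).
Proof.
move=> zj; split.
- by rewrite (char2_odd (c := 0%N) e zj) // expr0 mulr1; case: e.
- move=> m n; rewrite {2 3}/char2; have [/andP[om on]|] := boolP (odd m && odd n); last first.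
    rewrite -oddM => omn; rewrite /char2 (negbTE omn); move: omn; rewrite oddM negb_and.
    by case/orP => /negbTE ->; rewrite ?mul0r ?mulr0.
  rewrite om on (char2_odd (c := dlog j m + dlog j n) e zj) ?oddM ?om ?on //.
    by rewrite exprD sgn4M //; case: e; rewrite ?rmorphM /= ?mul1r // mulrACA.
  rewrite sgn4M // PoszM exprD.
  have -> : m%:Z * n%:Z * (sgn4 m * sgn4 n) - 5 ^+ dlog j m * 5 ^+ dlog j n =
    (m%:Z * sgn4 m - 5 ^+ dlog j m) * (n%:Z * sgn4 n) +
    5 ^+ dlog j m * (n%:Z * sgn4 n - 5 ^+ dlog j n) by ring.
  by apply: dvdz_add; [apply: dvdz_mulr|apply: dvdz_mull]; exact: dlogP.
- move=> n; rewrite /char2; case: ifP => _; last by rewrite Normc.normc0.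
  have nz : normc z = 1.
    have normX k : normc (z ^+ k) = normc z ^+ k.
      by elim: k => [|k IH]; rewrite ?expr0 ?Normc.normc1 // !exprS Normc.normcM IH.
    have := congr1 (@normc R) zj; rewrite normX Normc.normc1 => /eqP.
    by rewrite pexpr_eq1 ?expn_gt0 ?normc_ge0 // => /eqP.
  have nzk k : normc (z ^+ k) = 1.
    by elim: k => [|k IH]; rewrite ?expr0 ?Normc.normc1 // exprS Normc.normcM IH nz mulr1.
  rewrite Normc.normcM nzk mulr1 /sgn4; case: e; rewrite ?Normc.normc1 //.
  by case: ifP => _; rewrite ?mulrN1z ?normc_opp Normc.normc1.
Qed.

Lemma char2_periodic (R : realType) j e (z : R[i]) n : z ^+ (2 ^ j) = 1 ->
  char2 j e z (n + 2 ^ j.+2)%N = char2 j e z n.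
Proof.
move=> zj; have q4 : (2 ^ j.+2 = 4 * 2 ^ j)%N by rewrite !expnS mulnA.
have oq : odd (n + 2 ^ j.+2) = odd n by rewrite q4; lia.
rewrite {2}/char2; case: ifP => [on|on]; last by rewrite /char2 oq on.
have sq : sgn4 (n + 2 ^ j.+2) = sgn4 n by rewrite /sgn4 q4 addnC mulnC modnMDl.
rewrite (char2_odd (c := dlog j n) e zj) ?oq // sq //.
rewrite PoszD mulrDl addrAC; apply: dvdz_add; first exact: dlogP.
by apply: dvdz_mulr; rewrite -natz natrX.
Qed.

Lemma char2_bounded_sums (R : realType) j e (z : R[i]) : z ^+ (2 ^ j) = 1 ->
  e || (z != 1) -> bounded_sums (char2 j e z) (2 ^ j.+2)%:R.
Proof.
move=> zj nontriv; have chic := char2_is_char e zj.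
have per n := char2_periodic e n zj.
have [z1|z1] := eqVneq z 1.
  have e1 : e by move: nontriv; rewrite z1 eqxx orbF.
  (* At 3 the sign alone gives the value -1; in the other case 5, whose discrete logarithm is 1,
     gives the value [z]. *)
  apply: (periodic_bounded_sums (a := 3%N) chic) => //; first by rewrite expn_gt0.
    by rewrite coprimeXr.
  rewrite /char2 z1 /= e1 expr1n mulr1 /sgn4 /= mulrN1z.
  by rewrite eq_sym -subr_eq0 opprK -mulr2n pnatr_eq0.
apply: (periodic_bounded_sums (a := 5%N) chic) => //; first by rewrite expn_gt0.
  by rewrite coprimeXr.
have d5 : (2 ^+ j.+2 %| 5%:Z * sgn4 5 - 5 ^+ 1)%Z.
  by rewrite [5%:Z * _ - _](_ : _ = 0) ?dvdz0.
by rewrite (char2_odd e zj _ d5) // /sgn4 /=; case: (e); rewrite mul1r expr1.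
Qed.

Lemma char2_sqr (R : realType) j e (z : R[i]) :
  (fun n => char2 j e z n ^+ 2) = char2 j false (z ^+ 2).
Proof.
apply/funext => n; rewrite /char2; case: ifP => _; last by rewrite expr0n.
rewrite exprMn mul1r -!exprM mulnC; case: e; rewrite ?expr1n ?mul1r //.
by rewrite -rmorphXn /= sgn4_sqr mul1r.
Qed.

(** If [z ^ 2 = 1], only the parity of the discrete logarithm matters, and that is visible modulo
    8. *)
Lemma char2_real_level1 (R : realType) j e (z : R[i]) : z ^+ (2 ^ j) = 1 ->
  z ^+ 2 = 1 -> char2 j e z = char2 1 e z.
Proof.
move=> zj z2; apply/funext => n; have [on|on] := boolP (odd n); last first.
  by rewrite /char2 (negbTE on).
have [->|z1] := eqVneq z 1; first by rewrite /char2 on !expr1n.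
case: j zj => [|j] zj; first by move: z1; rewrite -zj expr1 eqxx.
rewrite (char2_odd (j := 1) (c := dlog j.+1 n) e z2 on) ?/char2 ?on //.
by apply: dvdz_trans (dlogP j.+1 on); rewrite dvdz_exp2l.
Qed.

Lemma char2_mangoldt_sum_bounded (R : realType) j e (z : R[i]) :
  z ^+ (2 ^ j) = 1 -> e || (z != 1) ->
  exists C, forall x, normc (mangoldt_sum (char2 j e z) x) <= C.
Proof.
move=> zj nontriv; have chic := char2_is_char e zj.
have chiB := char2_bounded_sums zj nontriv.
have [z2|z2] := eqVneq (z ^+ 2) 1; last first.
  apply: (mangoldt_sum_char_nonreal chic chiB (B' := (2 ^ j.+2)%:R)).
  rewrite char2_sqr; apply: char2_bounded_sums => //.
  by rewrite -exprM mulnC exprM zj expr1n.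
have [l hl] := char_limit chiB.
apply: (mangoldt_sum_bounded chic chiB _ hl).
have z21 : z ^+ (2 ^ 1) = 1 := z2.
move: hl; rewrite char2_real_level1 // => hl.
have val n c : odd n -> (8 %| n%:Z * sgn4 n - 5 ^+ c)%Z ->
    char2 1 e z n = (if e then (sgn4 n)%:~R else 1) * z ^+ c.
  by move=> on dv; apply: char2_odd.
apply: (harmonic_sum_real_mod8 _ _ _ _ hl).
- by move=> n; exact: (char2_periodic e n z21).
- by move=> n on; rewrite /char2 (negbTE on).
- by rewrite (val 1%N 0%N) // expr0 mulr1; case: (e).
rewrite (val 3%N 1%N) // (val 5%N 1%N) // (val 7%N 0%N) // expr0 expr1 mulr1 /sgn4 /=.
rewrite mulrN1z.
(* The case [z = 1] forces [e] and gives the character modulo 4; [z = -1] gives the two of conductor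
   8. *)
have /orP[/eqP zE|/eqP zE] : (z == 1) || (z == -1) by rewrite -sqrf_eq1 z2.
  move: nontriv; rewrite zE eqxx orbF => ->; apply: Or31.
  by rewrite mulr1 mul1r.
rewrite zE; case: (e); first by apply: Or33; rewrite mulrNN !mul1r.
by apply: Or32; rewrite mul1r.
Qed.

(** Repeated square roots of -1. The second clause is primitivity: if [b] had fewer than [j] factors
    2, some power of [w ^ b] would be an odd power of -1. *)
Lemma exists_primitive_root2 (R : rcfType) j :
  exists2 w : R[i], w ^+ (2 ^ j) = 1 & forall b, w ^+ b = 1 -> (2 ^ j %| b)%N.
Proof.
case: j => [|j]; first by exists 1; rewrite ?expr1n // => b _; rewrite dvd1n.
have [w wj] : exists w : R[i], w ^+ (2 ^ j) = -1.
  elim: j => [|j [w wj]]; first by exists (-1); rewrite expr1.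
  by exists (sqrtc w); rewrite expnS exprM sqr_sqrtc.
exists w; first by rewrite expnSr exprM wj sqrrN expr1n.
have neq : (-1 : R[i]) != 1.
  by rewrite eq_sym -subr_eq0 opprK -mulr2n pnatr_eq0.
move=> b wb; have [->|b0] := posnP b; first by rewrite dvdn0.
rewrite pfactor_dvdn // ltnNge; apply/negP => kj.
have [c c2 bE] := pfactor_coprime (p := 2) isT b0.
have : w ^+ (2 ^ j * c) = 1.
  rewrite (_ : 2 ^ j * c = b * 2 ^ (j - logn 2 b))%N ?exprM ?wb ?expr1n //.
  by rewrite {1}bE -mulnA -expnD subnKC 1?mulnC.
rewrite exprM wj -signr_odd; have -> : odd c by rewrite coprime2n in c2.
by rewrite expr1 => /eqP; rewrite (negbTE neq).
Qed.

Lemma sum_root_pow (R : rcfType) m (w : R[i]) b : w ^+ m = 1 ->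
  (forall b, w ^+ b = 1 -> (m %| b)%N) ->
  \sum_(0 <= i < m) (w ^+ i) ^+ b = if (m %| b)%N then m%:R else 0.
Proof.
move=> wm prim; have -> : \sum_(0 <= i < m) (w ^+ i) ^+ b = \sum_(i < m) (w ^+ b) ^+ i.
  by rewrite big_mkord; apply: eq_bigr => i _; rewrite -!exprM mulnC.
case: ifPn => [/dvdnP[c ->]|mb].
  rewrite mulnC exprM wm expr1n (eq_bigr (fun=> 1)) ?sumr_const ?card_ord //.
  by move=> i _; rewrite expr1n.
have : (w ^+ b - 1) * \sum_(i < m) (w ^+ b) ^+ i = 0.
  by rewrite -subrX1 -exprM mulnC exprM wm expr1n subrr.
move/eqP; rewrite mulf_eq0 subr_eq0 => /orP[/eqP/prim mb'|/eqP //].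
by rewrite mb' in mb.
Qed.

(** * Contribution of proper prime powers *)

Lemma sum_inv_pow_le (R : realFieldType) (p : R) m : 1 < p ->
  \sum_(2 <= a < m) p ^- a <= (p * (p - 1))^-1.
Proof.
move=> p1; have p0 : 0 < p by apply: lt_trans p1.
have [m2|m2] := leqP m 2; first by rewrite big_geq // invr_ge0 mulr_ge0 ?subr_ge0 ?ltW.
rewrite -(subnK m2); move: (m - 3)%N => k.
suff -> : \sum_(2 <= a < k + 3) p ^- a = (p * (p - 1))^-1 - (p ^+ k.+2 * (p - 1))^-1.
  by rewrite gerBl invr_ge0 mulr_ge0 ?exprn_ge0 ?subr_ge0 ?ltW.
have pN1 : p - 1 != 0 by rewrite subr_eq0 gt_eqF.
elim: k => [|k IH].
  by rewrite big_nat1; field; rewrite pN1 gt_eqF.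
rewrite addSn big_nat_recr ?IH //=; last lia.
have pk : p ^+ k != 0 by rewrite expf_neq0 ?gt_eqF.
by rewrite addn3 !exprS; field; rewrite pN1 pk gt_eqF.
Qed.

Lemma ln_nat_ge0 (R : realType) n : 0 <= ln n%:R :> R.
Proof. by case: n => [|n]; [rewrite ln0|rewrite ln_ge0 // ler1n]. Qed.

Lemma sum_ln_div_le (R : realType) x :
  \sum_(1 <= n < x.+1) ln n%:R / (n%:R * n.+1%:R) <= 1 :> R.
Proof.
suff : \sum_(1 <= n < x.+1) ln n%:R / (n%:R * n.+1%:R) <=
    1 - (1 + ln x.+1%:R) / x.+1%:R :> R.
  move/le_trans; apply; rewrite gerBl divr_ge0 // addr_ge0 // ln_ge0 // ler1n //.
elim: x => [|x IH]; first by rewrite big_geq // ln1 addr0 divr1 subrr.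
rewrite big_nat_recr //=; apply: (le_trans (lerD IH (oneDln_div_decr R (ltn0Sn x)))).
by rewrite addrA subrK.
Qed.

(** Only proper prime powers survive; they are dominated by a double sum over all [p, a >= 2], prime
    or not. The geometric series gives [ln p / (p * (p - 1))], and [p + 1 <= 3 * (p - 1)] reduces
    this to a telescoping sum at most 1. *)
Lemma sum_mangoldt_nonprime (R : realType) x :
  \sum_(1 <= n < x.+1 | ~~ prime n) mangoldt R n / n%:R <= 3.
Proof.
apply: (@le_trans _ _ (\sum_(1 <= n < x.+1) \sum_(2 <= p < x.+1) \sum_(2 <= a < x.+1)
    (n == p ^ a)%N%:R * (ln p%:R * p%:R ^- a))).
  rewrite big_mkcond /= ler_sum_nat // => n /andP[n1 nx].
  have pos p a : 0 <= (n == p ^ a)%N%:R * (ln p%:R * p%:R ^- a) :> R.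
    rewrite mulr_ge0 // mulr_ge0 ?invr_ge0 ?exprn_ge0 //.
    exact: ln_nat_ge0.
  have sum0 : 0 <= \sum_(2 <= p < x.+1) \sum_(2 <= a < x.+1)
     (n == p ^ a)%N%:R * (ln p%:R * p%:R ^- a) :> R.
    by apply: sumr_ge0 => p _; apply: sumr_ge0.
  case: ifPn => // np.
  have [->|/mangoldt_neq0[p pp [k nE]]] := eqVneq (mangoldt R n) 0; first by rewrite mul0r.
  case: k nE => [|k] nE; first by move: np; rewrite nE expn1 pp.
  have p1 := prime_gt1 pp.
  have pn : (p <= n)%N by rewrite nE expnS leq_pmulr // expn_gt0 ltnW.
  have kn : (k.+2 < n)%N by rewrite nE ltn_expl.
  rewrite (big_rem p) /=; last by rewrite mem_index_iota; lia.
  rewrite (big_rem k.+2) /=; last by rewrite mem_index_iota; lia.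
  rewrite nE eqxx mul1r mangoldt_pfactor // natrX -!addrA lerDl addr_ge0 //.
    by apply: sumr_ge0 => a _; rewrite -nE.
  by apply: sumr_ge0 => q _; apply: sumr_ge0 => a _; rewrite -nE.
rewrite exchange_big_nat /=.
apply: (@le_trans _ _ (\sum_(2 <= p < x.+1) 3 * (ln p%:R / (p%:R * p.+1%:R)))).
  apply: ler_sum_nat => p /andP[p2 px].
  have pR : 2 <= p%:R :> R by rewrite ler_nat.
  have lnp : 0 <= ln p%:R :> R by rewrite ln_ge0 //; lra.
  rewrite exchange_big_nat /=.
  apply: (@le_trans _ _ (\sum_(2 <= a < x.+1) ln p%:R * p%:R ^- a)).
    apply: ler_sum => a _; rewrite -mulr_suml ler_piMl ?mulr_ge0 ?invr_ge0 ?exprn_ge0 //.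
    have [pin|pout] := boolP ((p ^ a)%N \in index_iota 1 x.+1).
      rewrite (big_rem (p ^ a)%N) //= eqxx big_seq big1 ?addr0 // => n.
      by rewrite mem_rem_uniq ?iota_uniq // inE => /andP[/negbTE ->].
    rewrite big_seq big1 // => n; case: eqP => // -> pin; by rewrite pin in pout.
  rewrite -mulr_sumr mulrCA ler_wpM2l //.
  apply: (le_trans (sum_inv_pow_le _ _)); first lra.
  have q0 : 0 < p%:R * (p%:R - 1) :> R by rewrite mulr_gt0 //; lra.
  have q1 : 0 < p%:R * (p%:R + 1) :> R by rewrite mulr_gt0 //; lra.
  rewrite -natr1 -div1r ler_pdivrMr // mulrAC ler_pdivlMr //; nra.
rewrite -mulr_sumr -[leRHS]mulr1 ler_wpM2l //.
apply: le_trans (sum_ln_div_le R x).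
case: x => [|x]; first by rewrite !big_geq.
by rewrite [leRHS]big_ltn // ln1 mul0r add0r.
Qed.

(** * Primes congruent to -1 modulo powers of two *)

Lemma sum_mangoldt_even (R : realType) x :
  \sum_(1 <= n < x.+1 | ~~ odd n) mangoldt R n / n%:R <= 4.
Proof.
apply: (@le_trans _ _ (\sum_(1 <= n < x.+1 | ~~ prime n) mangoldt R n / n%:R +
    \sum_(1 <= n < x.+1) (n == 2)%N%:R)).
  rewrite big_mkcond [X in _ <= X + _]big_mkcond -big_split /= ler_sum // => n _.
  have g0 : 0 <= mangoldt R n / n%:R by rewrite divr_ge0 ?mangoldt_ge0.
  case: ifPn => [on|_]; last by rewrite addr_ge0 //; case: ifP.
  have [np|/negbNE pn] := boolP (~~ prime n); first by rewrite lerDl.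
  have -> : n = 2%N by case: (even_prime pn) => // on'; rewrite on' in on.
  rewrite eqxx add0r mangoldt_prime // ler_pdivrMr // mul1r.
  by rewrite (le_trans (ltW (ln_sublinear _))).
rewrite (_ : 4 = 3 + 1) ?lerD ?sum_mangoldt_nonprime //; last by ring.
have [x2|x2] := ltnP 1 x.
  rewrite (big_rem 2) /= ?mem_index_iota // big_seq big1 ?addr0 // => n.
  by rewrite mem_rem_uniq ?iota_uniq // inE => /andP[/negbTE ->].
by rewrite big_nat big1 ?ler01 // => n /andP[n1 nx]; case: eqP => // n2; lia.
Qed.

Lemma sum_mangoldt_odd (R : realType) x : (0 < x)%N ->
  ln x%:R - 5 <= \sum_(1 <= n < x.+1 | odd n) mangoldt R n / n%:R.
Proof.
move=> x0; have /andP[h _] := mertens_mangoldt R x0.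
move: h; rewrite (bigID odd) /=; have := sum_mangoldt_even R x; lra.
Qed.

(** Orthogonality at the class of -1: each character is weighted by its value at -1, which is -1
    exactly when [e] holds, and [2 ^ j.+1] is the number of characters. An inequality suffices
    because it is multiplied by [mangoldt n / n >= 0] in a lower bound. *)
Lemma char2_indicator (R : realType) j (w : R[i]) n :
  w ^+ (2 ^ j) = 1 -> (forall b, w ^+ b = 1 -> (2 ^ j %| b)%N) ->
  Re (\sum_(0 <= i < 2 ^ j) (char2 j false (w ^+ i) n - char2 j true (w ^+ i) n))
    <= if (2 ^ j.+2 %| n.+1)%N then (2 ^ j.+1)%:R else 0.
Proof.
move=> wj prim; have g0 : 0 <= (if (2 ^ j.+2 %| n.+1)%N then (2 ^ j.+1)%:R else 0) :> R.
  by case: ifP.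
rewrite /char2; have [on|on] := boolP (odd n); last first.
  by rewrite big1 // => i _; rewrite subrr.
rewrite (eq_bigr (fun i => (1 - (sgn4 n)%:~R) * (w ^+ i) ^+ dlog j n)); last first.
  by move=> i _; rewrite mulrBl.
rewrite -mulr_sumr sum_root_pow //; case: ifPn => [dv|_]; last by rewrite mulr0.
rewrite /sgn4; case: ifP => n4; first by rewrite subrr mul0r.
rewrite mulrN1z opprK ifT; last first.
  have := dlogP j on; rewrite /sgn4 n4 mulrN1.
  have -> : - n%:Z - 5 ^+ dlog j n = - (n.+1%:Z + (5 ^+ dlog j n - 1)).
    by rewrite -natr1 natz; ring.
  rewrite dvdz_opp addrC dvdz_addr ?dvdz_expr5_subr1 //.
  by rewrite -natrX natz.
have -> : (1 + 1) * (2 ^ j)%:R = ((2 ^ j.+1)%:R : R)%:C.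
  by rewrite expnS natrM rmorphM /= !rmorph_nat -natr1.
by [].
Qed.

Lemma mangoldt_progression (R : realType) j : exists C : R, forall x, (0 < x)%N ->
  ln x%:R / (2 ^ j.+1)%:R - C <=
  \sum_(1 <= n < x.+1 | (2 ^ j.+2 %| n.+1)%N) mangoldt R n / n%:R.
Proof.
have [w wj prim] := exists_primitive_root2 R j.
have wij i : (w ^+ i) ^+ (2 ^ j) = 1 by rewrite -exprM mulnC exprM wj expr1n.
(* For the principal character only [0 <= C] is retained, so that its constant can stay in the sum
   below without harm. *)
have /choice[C hC] : forall p : bool * nat, exists C : R, 0 <= C /\
    (p.1 || (w ^+ p.2 != 1) -> forall x, normc (mangoldt_sum (char2 j p.1 (w ^+ p.2)) x) <= C).
  case=> e i /=; have [nontriv|_] := boolP (e || _); last by exists 0.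
  have [C hC] := char2_mangoldt_sum_bounded (wij i) nontriv.
  by exists C; split=> //; apply: le_trans (hC 0%N); exact: normc_ge0.
exists ((5 + \sum_(0 <= i < 2 ^ j) (C (false, i) + C (true, i))) / (2 ^ j.+1)%:R) => x x0.
have q0 : 0 < (2 ^ j.+1)%:R :> R by rewrite ltr0n expn_gt0.
rewrite -mulrBl ler_pdivrMr // mulr_suml.
pose S := \sum_(0 <= i < 2 ^ j)
   (mangoldt_sum (char2 j false (w ^+ i)) x - mangoldt_sum (char2 j true (w ^+ i)) x).
apply: (@le_trans _ _ (Re S)); last first.
  have -> : S = \sum_(1 <= n < x.+1) (\sum_(0 <= i < 2 ^ j)
       (char2 j false (w ^+ i) n - char2 j true (w ^+ i) n)) * (mangoldt R n / n%:R)%:C.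
    under [RHS]eq_bigr do rewrite mulr_suml.
    rewrite exchange_big; apply: eq_bigr => i _ /=.
    by rewrite -sumrB; apply: eq_bigr => n _; rewrite mulrBl.
  rewrite Re_sum [leRHS]big_mkcond ler_sum // => n _; rewrite Re_mulr.
  have g0 : 0 <= mangoldt R n / n%:R by rewrite divr_ge0 ?mangoldt_ge0.
  apply: (le_trans (ler_wpM2r g0 (char2_indicator n wj prim))).
  by case: ifP; rewrite ?mul0r // mulrC.
have Re_le (z : R[i]) c : normc z <= c -> - c <= Re z.
  by move=> zc; have := le_trans (normc_ge_absRe z) zc; rewrite ler_norml => /andP[].
have Re_le' (z : R[i]) c : normc z <= c -> Re z <= c.
  by move=> zc; have := le_trans (normc_ge_absRe z) zc; rewrite ler_norml => /andP[].
have term i : (0 < i < 2 ^ j)%N -> - (C (false, i) + C (true, i)) <=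
   Re (mangoldt_sum (char2 j false (w ^+ i)) x - mangoldt_sum (char2 j true (w ^+ i)) x).
  move=> /andP[i0 ij]; rewrite ReB.
  have nt : w ^+ i != 1.
    by apply: contraTneq ij => /prim/dvdn_leq; rewrite -leqNgt; exact.
  have := Re_le _ _ ((hC (false, i)).2 nt x).
  have := Re_le' _ _ ((hC (true, i)).2 isT x); rewrite /=; lra.
have term0 : ln x%:R - 5 - C (true, 0%N) <=
   Re (mangoldt_sum (char2 j false (w ^+ 0)) x - mangoldt_sum (char2 j true (w ^+ 0)) x).
  rewrite ReB; have := Re_le' _ _ ((hC (true, 0%N)).2 isT x); rewrite /=.
  have -> : Re (mangoldt_sum (char2 j false (w ^+ 0)) x) =
      \sum_(1 <= n < x.+1 | odd n) mangoldt R n / n%:R.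
    rewrite /mangoldt_sum Re_sum [RHS]big_mkcond; apply: eq_bigr => n _.
    rewrite Re_mulr /char2 expr0 expr1n mul1r; case: ifP => _ /=; by rewrite ?mul1r ?mul0r.
  have := sum_mangoldt_odd R x0; lra.
rewrite /S Re_sum !(big_ltn (expn_gt0 2 j)) //=.
have : - \sum_(1 <= i < 2 ^ j) (C (false, i) + C (true, i)) <= \sum_(1 <= i < 2 ^ j)
   Re (mangoldt_sum (char2 j false (w ^+ i)) x - mangoldt_sum (char2 j true (w ^+ i)) x).
  by rewrite -sumrN; apply: ler_sum_nat => i; exact: term.
have [c0 _] := hC (false, 0%N).
move: term0; lra.
Qed.

Lemma prime_progression_ln (R : realType) k : exists C : R, forall x, (0 < x)%N ->
  ln x%:R / (2 ^ k)%:R - C <=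
  \sum_(1 <= p < x.+1 | [&& prime p, odd p & (2 ^ k.+1 %| p.+1)%N]) ln p%:R / p%:R.
Proof.
have main (P : pred nat) (C c : R) : (forall n, P n -> odd n) ->
    (forall x, (0 < x)%N -> c * ln x%:R - C <= \sum_(1 <= n < x.+1 | P n) mangoldt R n / n%:R) ->
    forall x, (0 < x)%N -> c * ln x%:R - (C + 3) <=
      \sum_(1 <= p < x.+1 | [&& prime p, odd p & P p]) ln p%:R / p%:R.
  move=> Podd h x x0; have := h x x0; rewrite (bigID prime) /=.
  have -> : \sum_(1 <= i < x.+1 | P i && prime i) mangoldt R i / i%:R =
      \sum_(1 <= p < x.+1 | [&& prime p, odd p & P p]) ln p%:R / p%:R.
    apply: eq_big => [p|p /andP[_ pp]]; last by rewrite mangoldt_prime.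
    by case Pp: (P p); rewrite ?andbF // andbT (Podd p Pp) andbT.
  have : \sum_(1 <= i < x.+1 | P i && ~~ prime i) mangoldt R i / i%:R <= 3.
    apply: le_trans (sum_mangoldt_nonprime R x).
    rewrite [leLHS]big_mkcond [leRHS]big_mkcond ler_sum // => n _.
    by case: (P n); case: (prime n) => //=; rewrite divr_ge0 ?mangoldt_ge0.
  lra.
(* Modulus 2 lies below the range of [char2]; there all odd primes count, with density 1. *)
case: k => [|j].
  exists (5 + 3) => x x0; rewrite expn0 divr1.
  have := @main odd 5 1 (fun _ => id) _ x x0; rewrite !mul1r.
  have h y : (0 < y)%N -> 1 * ln y%:R - 5 <=
      \sum_(1 <= n < y.+1 | odd n) mangoldt R n / n%:R.
    by rewrite mul1r; exact: sum_mangoldt_odd.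
  move/(_ h)/le_trans; apply; rewrite le_eqVlt; apply/orP; left; apply/eqP.
  apply: eq_bigl => p; case op: (odd p); rewrite ?andbF //= ?andbT.
  by rewrite expn1 dvdn2 /= op andbT.
have [C hC] := mangoldt_progression R j.
exists (C + 3) => x x0.
have := @main (fun n => (2 ^ j.+2 %| n.+1)%N) C (2 ^ j.+1)%:R^-1.
rewrite [_ / _]mulrC; apply => // [n|y y0]; last by rewrite mulrC; exact: hC.
by move/(dvdn_trans (dvdn_exp2l 2 (isT : 1 <= j.+2)%N)); rewrite expn1 dvdn2 /= negbK.
Qed.

Lemma partial_summation_lnln (R : realType) (a : nat -> R) (c C : R) :
  (forall n, 0 <= a n) -> a 1%N = 0 -> 0 <= c -> 0 <= C ->
  (forall x, (0 < x)%N -> c * ln x%:R - C <= \sum_(1 <= n < x.+1) a n) ->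
  exists D, forall x, (1 < x)%N ->
    c * ln (ln x%:R) - D <= \sum_(1 <= n < x.+1) a n / ln n%:R.
Proof.
move=> a0 a1 c0 C0 hA; pose A x := \sum_(1 <= n < x.+1) a n.
exists (c * ln (ln 2) + (C + c) / ln 2) => x x1.
have lnpos n : (1 < n)%N -> 0 < ln n%:R :> R by move=> n1; rewrite ln_gt0 // ltr1n.
have lnS n : (0 < n)%N ->
    (ln n%:R <= ln n.+1%:R :> R) && (ln n.+1%:R <= ln n%:R + 1 :> R).
  move=> n0; have nR : 0 < n%:R :> R by rewrite ltr0n.
  rewrite ler_ln ?posrE ?ltr0n // ler_nat leqnSn /=.
  rewrite -[X in _ + X](@expRK R) -lnM ?posrE ?expR_gt0 // ler_ln ?posrE ?mulr_gt0 ?expR_gt0 ?ltr0n //.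
  have : 2 <= expR 1 :> R by have := expR_ge1Dx (1 : R); lra.
  have : 1 <= n%:R :> R by rewrite ler1n.
  rewrite -natr1; nra.
(* Summation by parts as an inductive lower bound; the subtracted constant makes it an equality at
   [z = 1]. The extra [c] in [C + c] absorbs the step [ln (n + 1) <= ln n + 1]. *)
have key z : (0 < z)%N ->
    A z / ln z.+1%:R + c * ln (ln z.+1%:R) + (C + c) / ln z.+1%:R
      - (c * ln (ln 2) + (C + c) / ln 2) <= \sum_(1 <= n < z.+1) a n / ln n%:R.
  case: z => // z _; elim: z => [|z IH].
    by rewrite /A !big_nat1 a1 !mul0r add0r subrr.
  rewrite [leRHS]big_nat_recr //=; apply: le_trans (lerD IH (lexx _)).
  have AE : A z.+2 = A z.+1 + a z.+2 by rewrite /A big_nat_recr.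
  have /andP[l1 l2] := lnS z.+2 isT.
  have lp := lnpos z.+2 isT.
  have lp' := lnpos z.+3 isT.
  have hAz := hA z.+2 isT; rewrite -/(A _) in hAz.
  set L := ln z.+2%:R in l1 l2 lp hAz *; set L' := ln z.+3%:R in l1 l2 lp' *.
  have lnL : ln L' - ln L <= (L' - L) / L.
    rewrite -ln_div ?posrE // (_ : L' / L = 1 + (L' - L) / L); last by field; rewrite gt_eqF.
    by rewrite le_ln1Dx // (lt_le_trans (ltrN10 _)) // divr_ge0 ?subr_ge0 // ltW.
  have d0 : 0 <= L^-1 - L'^-1 by rewrite subr_ge0 lef_pV2 ?posrE.
  have h1 : c * (L' - L) / L <= (A z.+2 + C + c) * (L^-1 - L'^-1).
    apply: (@le_trans _ _ (c * (L + 1) * (L^-1 - L'^-1))); last first.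
      by rewrite ler_wpM2r //; move: hAz; lra.
    rewrite (_ : c * (L + 1) * _ = c * (L' - L) / L * ((L + 1) / L')); last first.
      by field; rewrite !gt_eqF.
    rewrite ler_peMr ?divr_ge0 ?mulr_ge0 ?subr_ge0 ?(ltW lp) //.
    by rewrite ler_pdivlMr // mul1r.
  have := ler_wpM2l c0 lnL; rewrite mulrA AE in h1 *; move: h1.
  rewrite !mulrDl !mulrDr; lra.
have l2x : ln x%:R <= ln x.+1%:R :> R by have /andP[] := lnS x (ltnW x1).
have lx := lnpos x x1.
apply: le_trans (key x (ltnW x1)); rewrite lerD2r.
apply: (@le_trans _ _ (c * ln (ln x.+1%:R))).
  by rewrite ler_wpM2l // ler_ln ?posrE // (lt_le_trans lx).
have : 0 <= A x / ln x.+1%:R by rewrite divr_ge0 ?sumr_ge0 // (le_trans (ltW lx)).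
have : 0 <= (C + c) / ln x.+1%:R by rewrite divr_ge0 ?addr_ge0 // (le_trans (ltW lx)).
lra.
Qed.

Lemma prime_progression_inv (R : realType) k : exists C : R, forall x, (1 < x)%N ->
  ln (ln x%:R) / (2 ^ k)%:R - C <=
  \sum_(1 <= p < x.+1 | [&& prime p, odd p & (2 ^ k.+1 %| p.+1)%N]) p%:R^-1.
Proof.
pose P p := [&& prime p, odd p & (2 ^ k.+1 %| p.+1)%N].
have [C hC] := prime_progression_ln R k.
have [|||||D hD] := @partial_summation_lnln R (fun n => if P n then ln n%:R / n%:R else 0)
    (2 ^ k)%:R^-1 `|C|.
- by move=> n; case: ifP => // _; rewrite divr_ge0 // ln_nat_ge0.
- by [].
- by rewrite invr_ge0.
- by [].
- move=> x x0; rewrite -big_mkcond mulrC; apply: le_trans (hC x x0).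
  by rewrite lerD2l lerN2 ler_norm.
exists D => x x1; rewrite mulrC; apply: (le_trans (hD x x1)).
rewrite [leRHS]big_mkcond le_eqVlt; apply/orP; left; apply/eqP.
apply: eq_bigr => n _; rewrite -/(P n); case: ifP => [/and3P[pn _ _]|_]; last by rewrite mul0r.
by rewrite mulrAC divff ?mul1r // gt_eqF // ln_gt0 // ltr1n prime_gt1.
Qed.

(** * Turan's variance bound *)

(** At odd primes this equals [minn K (logn 2 p.+1)]; the sum over [k] splits its mean into one
    progression per modulus. *)
Definition weight (K p : nat) : nat :=
  if prime p && odd p then (\sum_(0 <= k < K) (2 ^ k.+1 %| p.+1))%N else 0%N.

Definition weight_mean (R : realType) (K z : nat) : R :=
  \sum_(1 <= p < z.+1) (weight K p)%:R / p%:R.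

Lemma weight_le_logn K p : (weight K p <= minn K (logn 2 p.+1))%N.
Proof.
rewrite /weight; case: ifP => // _.
elim: K => [|K IH]; first by rewrite big_geq.
rewrite big_nat_recr //= pfactor_dvdn //; move: IH; lia.
Qed.

Lemma weight_le K p : (weight K p <= K)%N.
Proof. exact: leq_trans (weight_le_logn K p) (geq_minl _ _). Qed.

Lemma weight_neq0 K p : (weight K p != 0)%N -> prime p && odd p.
Proof. by rewrite /weight; case: ifP. Qed.

(** Each [k < K] contributes density [1 / 2 ^ k]; these add up to [2 - 2 / 2 ^ K]. *)
Lemma weight_mean_ge (R : realType) K : exists C : R, forall z, (1 < z)%N ->
  (2 - 2 / (2 ^ K)%:R) * ln (ln z%:R) - C <= weight_mean R K z.
Proof.
elim: K => [|K [C hC]].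
  exists 0 => z _; rewrite expn0 divr1 subrr mul0r subrr.
  by apply: sumr_ge0 => p _; rewrite divr_ge0.
have [D hD] := prime_progression_inv R K.
exists (C + D) => z z1; have := hC z z1; have := hD z z1.
have -> : weight_mean R K.+1 z = weight_mean R K z +
   \sum_(1 <= p < z.+1 | [&& prime p, odd p & (2 ^ K.+1 %| p.+1)%N]) p%:R^-1.
  rewrite [X in _ + X]big_mkcond -big_split /=; apply: eq_bigr => p _.
  rewrite /weight big_nat_recr //= andbA; case: (prime p && odd p) => /=; last first.
    by rewrite mul0r addr0.
  by rewrite natrD mulrDl; case: (_ %| _)%N; rewrite ?mul1r ?mul0r.
have K0 : (2 ^ K)%:R != 0 :> R by rewrite pnatr_eq0 -lt0n expn_gt0.
have -> : 2 - 2 / (2 ^ K.+1)%:R = (2 - 2 / (2 ^ K)%:R) + (2 ^ K)%:R^-1 :> R.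
  by rewrite expnS natrM; field.
rewrite mulrDl; lra.
Qed.

Lemma count_odd_multiples x d : odd d ->
  (\sum_(1 <= n < x.+1 | odd n && (d %| n)) 1 = uphalf (x %/ d))%N.
Proof.
move=> od; have d0 : (0 < d)%N by case: d od.
elim: x => [|x IH]; first by rewrite big_geq // div0n.
rewrite big_mkcond big_nat_recr //= -big_mkcond IH divnS //.
case: (boolP (d %| x.+1)%N) => [dv|_]; last by rewrite andbF addn0.
have xE : x.+1 = ((x %/ d).+1 * d)%N.
  by rewrite -[in LHS](divnK dv) divnS // dv add1n.
rewrite -[~~ odd x]/(odd x.+1) xE oddM od !andbT add1n; case: ifP => /=; lia.
Qed.

Lemma count_odd_multiples_bounds (R : realType) x d : odd d ->
  (x%:R / 2 / d%:R - 1 <= (\sum_(1 <= n < x.+1 | odd n && (d %| n)%N) 1 : R)) &&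
  ((\sum_(1 <= n < x.+1 | odd n && (d %| n)%N) 1 : R) <= x%:R / 2 / d%:R + 1).
Proof.
move=> od; have d0 : (0 < d)%N by case: d od.
have -> : (\sum_(1 <= n < x.+1 | odd n && (d %| n)%N) 1 : R) = (uphalf (x %/ d))%:R.
  by rewrite -(count_odd_multiples x od) natr_sum.
have dR : 0 < d%:R :> R by rewrite ltr0n.
have h1 : (x %/ d)%:R <= x%:R / d%:R :> R.
  by rewrite ler_pdivlMr // -natrM ler_nat leq_divM.
have h2 : x%:R / d%:R <= (x %/ d)%:R + 1 :> R.
  rewrite ler_pdivrMr // natr1 -natrM ler_nat ltnW //.
  by rewrite {1}(divn_eq x d) mulSn addnC ltn_add2r ltn_pmod.
have h3 : (x %/ d)%:R <= 2 * (uphalf (x %/ d))%:R :> R by rewrite -natrM ler_nat; lia.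
have h4 : 2 * (uphalf (x %/ d))%:R <= (x %/ d)%:R + 1 :> R.
  by rewrite natr1 -natrM ler_nat; lia.
rewrite mulrAC; apply/andP; split; lra.
Qed.

(** On expanding the square the main terms, multiples of [x / 2 * E ^ 2], cancel. The diagonal
    leaves at most [x / 2 * K * E], the weights being at most [K]. Rounding costs
    [W ^ 2 + 2 * E * W + E ^ 2 <= 4 * W ^ 2], where [W <= K * z] and [z * z <= x]. *)
Lemma turan_variance (R : realType) (K x z : nat) : (z * z <= x)%N ->
  \sum_(1 <= n < x.+1 | odd n)
    (\sum_(1 <= p < z.+1 | (p %| n)%N) (weight K p)%:R - weight_mean R K z) ^+ 2
  <= x%:R * (K%:R * weight_mean R K z + 4 * K%:R ^+ 2).
Proof.
move=> zx; set E := weight_mean R K z; pose w p : R := (weight K p)%:R.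
pose X : R := x%:R / 2; pose W := \sum_(1 <= p < z.+1) w p.
pose cnt d := \sum_(1 <= n < x.+1 | odd n && (d %| n)%N) (1 : R).
have w0 p : 0 <= w p by [].
have X0 : 0 <= X by rewrite divr_ge0.
have wK p : w p <= K%:R by rewrite ler_nat weight_le.
have W0 : 0 <= W by exact: sumr_ge0.
have E0 : 0 <= E by apply: sumr_ge0 => p _; rewrite divr_ge0.
have WK : W <= K%:R * z%:R.
  apply: (@le_trans _ _ (\sum_(1 <= p < z.+1) K%:R)); first exact: ler_sum.
  by rewrite sumr_const_nat subSS subn0 mulr_natr.
have EW : E <= W.
  apply: ler_sum_nat => p /andP[p1 _]; rewrite ler_pdivrMr ?ltr0n //.
  by rewrite ler_peMr // ler1n.
have S0 : \sum_(1 <= n < x.+1 | odd n) 1 <= X + 1.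
  have /andP[_] := count_odd_multiples_bounds R x (isT : odd 1).
  by rewrite divr1 (eq_bigl odd) // => n; rewrite dvd1n andbT.
have S1 : X * E - W <= \sum_(1 <= n < x.+1 | odd n) \sum_(1 <= p < z.+1 | (p %| n)%N) w p.
  rewrite (exchange_big_dep_nat xpredT) //= /E /weight_mean mulr_sumr -sumrB.
  apply: ler_sum => p _.
  have [w1|/weight_neq0/andP[pp op]] := eqVneq (weight K p) 0%N.
    by rewrite /w w1 mul0r mulr0 subr0; apply: sumr_ge0.
  have /andP[h _] := count_odd_multiples_bounds R x op.
  rewrite -[X in _ <= X]/(\sum_(1 <= n < x.+1 | odd n && (p %| n)%N) w p).
  have -> : \sum_(1 <= n < x.+1 | odd n && (p %| n)%N) w p = w p * cnt p.
    by rewrite /cnt mulr_sumr; apply: eq_bigr => n _; rewrite mulr1.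
  have := ler_wpM2l (w0 p) h; rewrite -/X -/(cnt p) -/(w p); lra.
have S2 : \sum_(1 <= n < x.+1 | odd n) (\sum_(1 <= p < z.+1 | (p %| n)%N) w p) ^+ 2 <=
    X * E ^+ 2 + W ^+ 2 + X * K%:R * E.
  have -> : \sum_(1 <= n < x.+1 | odd n) (\sum_(1 <= p < z.+1 | (p %| n)%N) w p) ^+ 2 =
      \sum_(1 <= p < z.+1) \sum_(1 <= q < z.+1)
        \sum_(1 <= n < x.+1 | odd n && ((p %| n)%N && (q %| n)%N)) w p * w q.
    transitivity (\sum_(1 <= n < x.+1 | odd n) \sum_(1 <= p < z.+1 | (p %| n)%N)
       \sum_(1 <= q < z.+1 | (q %| n)%N) w p * w q).
      by apply: eq_bigr => n _; rewrite expr2 mulr_suml; apply: eq_bigr => p _; rewrite mulr_sumr.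
    rewrite (exchange_big_dep_nat xpredT) //=; apply: eq_bigr => p _.
    rewrite (exchange_big_dep_nat xpredT) //=; apply: eq_bigr => q _.
    by apply: eq_bigl => n; rewrite andbA.
  (* The inner sum accounts for all pairs, [q = p] included; the last summand is the surplus of the
     diagonal. *)
  have -> : X * E ^+ 2 + W ^+ 2 + X * K%:R * E =
     \sum_(1 <= p < z.+1) (\sum_(1 <= q < z.+1) (X * (w p / p%:R) * (w q / q%:R) + w p * w q)
        + X * K%:R * (w p / p%:R)).
    rewrite big_split /= -mulr_sumr; congr (_ + _).
    under [RHS]eq_bigr do rewrite big_split /= -!mulr_sumr.
    by rewrite big_split /= -!mulr_suml -mulr_sumr !expr2 mulrA.
  apply: ler_sum_nat => p /andP[p1 pz].
  have pR : 0 < p%:R :> R by rewrite ltr0n.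
  have [wp0|/weight_neq0/andP[pp op]] := eqVneq (weight K p) 0%N.
    rewrite big1 ?addr_ge0 ?sumr_ge0 ?mulr_ge0 ?divr_ge0 // => [q _|q _].
      by rewrite addr_ge0 ?mulr_ge0 ?divr_ge0.
    by rewrite big1 // => n _; rewrite /w wp0 mul0r.
  have bound q : (1 <= q < z.+1)%N -> q != p ->
      \sum_(1 <= n < x.+1 | odd n && ((p %| n)%N && (q %| n)%N)) w p * w q <=
      X * (w p / p%:R) * (w q / q%:R) + w p * w q.
    move=> /andP[q1 _] qp.
    have [wq0|/weight_neq0/andP[pq oq]] := eqVneq (weight K q) 0%N.
      rewrite /w wq0 mulr0 big1 ?addr_ge0 ?mulr_ge0 ?divr_ge0 //.
    have cop : coprime p q by rewrite prime_coprime // dvdn_prime2 // eq_sym.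
    have -> : \sum_(1 <= n < x.+1 | odd n && ((p %| n)%N && (q %| n)%N)) w p * w q =
       w p * w q * cnt (p * q)%N.
      rewrite /cnt mulr_sumr; apply: eq_big => n; last by rewrite mulr1.
      by rewrite Gauss_dvd.
    have opq : odd (p * q) by rewrite oddM op.
    have /andP[_ h] := count_odd_multiples_bounds R x opq.
    apply: le_trans (ler_wpM2l (mulr_ge0 (w0 p) (w0 q)) h) _.
    rewrite -/X natrM invfM le_eqVlt; apply/orP; left; apply/eqP; ring.
  have diag : \sum_(1 <= n < x.+1 | odd n && ((p %| n)%N && (p %| n)%N)) w p * w p <=
      X * (w p / p%:R) * (w p / p%:R) + w p * w p + X * K%:R * (w p / p%:R).
    have -> : \sum_(1 <= n < x.+1 | odd n && ((p %| n)%N && (p %| n)%N)) w p * w p =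
       w p * w p * cnt p.
      rewrite /cnt mulr_sumr; apply: eq_big => n; last by rewrite mulr1.
      by rewrite andbb.
    have /andP[_ h] := count_odd_multiples_bounds R x op.
    apply: le_trans (ler_wpM2l (mulr_ge0 (w0 p) (w0 p)) h) _; rewrite -/X.
    have h1 : 0 <= X * (w p / p%:R) * (w p / p%:R) by rewrite !mulr_ge0 ?divr_ge0.
    have h2 : w p * (X * (w p / p%:R)) <= K%:R * (X * (w p / p%:R)).
      by rewrite ler_wpM2r // mulr_ge0 ?divr_ge0.
    have -> : w p * w p * (X / p%:R + 1) = w p * (X * (w p / p%:R)) + w p * w p.
      by ring.
    by move: h1 h2; rewrite [X * K%:R]mulrC -[K%:R * X * _]mulrA; lra.
  have pin : p \in index_iota 1 z.+1 by rewrite mem_index_iota p1.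
  rewrite (big_rem p pin) [X in _ <= X + _](big_rem p pin) /= addrAC lerD //.
  rewrite big_seq [leRHS]big_seq ler_sum // => q.
  rewrite mem_rem_uniq ?iota_uniq // inE mem_index_iota => /andP[qp qz].
  exact: bound.
have -> : \sum_(1 <= n < x.+1 | odd n)
    (\sum_(1 <= p < z.+1 | (p %| n)%N) (weight K p)%:R - E) ^+ 2 =
   \sum_(1 <= n < x.+1 | odd n) (\sum_(1 <= p < z.+1 | (p %| n)%N) w p) ^+ 2
   - 2 * E * (\sum_(1 <= n < x.+1 | odd n) \sum_(1 <= p < z.+1 | (p %| n)%N) w p)
   + E ^+ 2 * \sum_(1 <= n < x.+1 | odd n) 1.
  rewrite [2 * E * _]mulr_sumr [E ^+ 2 * _]mulr_sumr -sumrB -big_split /=.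
  apply: eq_bigr => n _.
  by rewrite mulr1 -/w; set s := \sum_(_ <= _ < _ | _) _; ring.
have h1 := ler_wpM2l (mulr_ge0 (ler0n R 2) E0) S1.
have h2 := ler_wpM2l (sqr_ge0 E) S0.
have WW : W ^+ 2 <= K%:R ^+ 2 * x%:R.
  apply: (@le_trans _ _ ((K%:R * z%:R) ^+ 2)).
    by rewrite ler_sqr ?nnegrE // (le_trans W0).
  by rewrite exprMn ler_wpM2l ?sqr_ge0 // -natrX ler_nat expnS expn1.
have EWW : E * W <= W ^+ 2 by rewrite expr2 ler_wpM2r.
have EE : E ^+ 2 <= W ^+ 2 by rewrite ler_sqr ?nnegrE.
have KE : 0 <= x%:R * K%:R * E by rewrite !mulr_ge0.
move: S2 h1 h2 WW EWW EE KE; rewrite /X; lra.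
Qed.

(** * The two-adic valuation of sigma *)

Lemma sigma_gt0 n : (0 < n)%N -> (0 < sigma n)%N.
Proof.
move=> n0; rewrite /sigma (big_rem n) /=; last by rewrite -dvdn_divisors.
by rewrite addn_gt0 n0.
Qed.

Lemma sigmaE n : (0 < n)%N -> sigma n = (\sum_(1 <= d < n.+1 | d %| n) d)%N.
Proof.
move=> n0; rewrite /sigma -[RHS]big_filter; apply: perm_big.
apply: uniq_perm; rewrite ?divisors_uniq ?filter_uniq ?iota_uniq // => d.
rewrite mem_filter mem_index_iota -dvdn_divisors //.
have [dn|//] := boolP (d %| n)%N.
by rewrite /= ltnS (dvdn_leq n0 dn) (dvdn_gt0 n0 dn).
Qed.

Lemma sigma_mul_prime p m : prime p -> (0 < m)%N -> ~~ (p %| m)%N ->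
  sigma (p * m) = (p.+1 * sigma m)%N.
Proof.
move=> pp m0 pm; have p0 := prime_gt0 pp.
have pm0 : (0 < p * m)%N by rewrite muln_gt0 p0.
rewrite /sigma (perm_big (divisors m ++ [seq p * d | d <- divisors m])%N) /=.
  by rewrite big_cat big_map -big_distrr /= mulSn.
have pinj : injective (muln p) by move=> a b /eqP; rewrite eqn_pmul2l // => /eqP.
apply: uniq_perm; rewrite ?divisors_uniq //.
  rewrite cat_uniq divisors_uniq map_inj_uniq // divisors_uniq andbT /=.
  apply/hasPn => _ /mapP[d _ ->]; rewrite -dvdn_divisors //.
  by apply: contra pm; apply: dvdn_trans; rewrite dvdn_mulr.
move=> d; rewrite mem_cat -!dvdn_divisors //; apply/idP/orP => [dpm|[dm|/mapP[e em ->]]].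
- have [/dvdnP[e de]|pd] := boolP (p %| d)%N.
    right; apply/mapP; exists e; last by rewrite mulnC.
    by rewrite -dvdn_divisors // -(dvdn_pmul2l p0) mulnC -de.
  by left; move: dpm; rewrite Gauss_dvdr // coprime_sym prime_coprime.
- exact: dvdn_mull.
- by rewrite dvdn_pmul2l // dvdn_divisors.
Qed.

Lemma sum_logn_le_logn_sigma (s : seq nat) n : (0 < n)%N -> uniq s ->
  (forall p, p \in s -> [/\ prime p, (p %| n)%N & ~~ (p ^ 2 %| n)%N]) ->
  (\sum_(p <- s) logn 2 p.+1 <= logn 2 (sigma n))%N.
Proof.
elim: s n => [|p s IH] n n0 /=; first by rewrite big_nil.
case/andP => ps us h; rewrite big_cons.
have [pp /dvdnP[m nE] p2] := h p (mem_head _ _).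
have m0 : (0 < m)%N by case: m nE n0 => // ->.
have pm : ~~ (p %| m)%N.
  by apply: contra p2 => pm; rewrite nE expnS expn1 dvdn_mul.
rewrite nE mulnC sigma_mul_prime // lognM ?sigma_gt0 // leq_add2l.
apply: IH => // q qs; have [pq qn q2] := h q (mem_behead (s := p :: s) qs).
have qp : q != p by apply: contraNneq ps => <-.
split=> //; last by apply: contra q2; rewrite nE; exact: dvdn_mulr.
by move: qn; rewrite nE Gauss_dvdl // prime_coprime // dvdn_prime2.
Qed.

(** A prime with [p ^ 2 %| n] guarantees no factor [p + 1] of [sigma n]; its weight, at most [K], is
    charged to the error. *)
Lemma sum_weight_le K z n : odd n ->
  (\sum_(1 <= p < z.+1 | p %| n) weight K p <=
   logn 2 (sigma n) + K * \sum_(2 <= p < z.+1 | p ^ 2 %| n) 1)%N.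
Proof.
move=> on; have n0 : (0 < n)%N by case: n on.
rewrite (bigID (fun p => prime p && ~~ (p ^ 2 %| n)%N)) /= leq_add //.
  rewrite -big_filter.
  apply: (@leq_trans (\sum_(p <- [seq p <- index_iota 1 z.+1 |
      (p %| n) && (prime p && ~~ (p ^ 2 %| n))]) logn 2 p.+1)%N).
    by apply: leq_sum => p _; apply: leq_trans (weight_le_logn K p) (geq_minr _ _).
  apply: sum_logn_le_logn_sigma; rewrite ?filter_uniq ?iota_uniq // => p.
  by rewrite mem_filter => /andP[/and3P[? ? ?] _].
rewrite big_distrr /= muln1.
case: z => [|z]; first by rewrite big_geq.
(* The term [p = 1] has weight 0, so the error sum starts at 2 and does not count the divisor 1 of
   every [n]. *)
rewrite big_mkcond big_ltn //= {1}/weight /= if_same add0n [leqRHS]big_mkcond /=.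
apply: leq_sum => p _; have [dv|_] := boolP (p %| n)%N => //=.
have [p2|p2] := boolP (p ^ 2 %| n)%N; rewrite ?andbF ?andbT /= ?weight_le //.
by rewrite /weight; case: (prime p).
Qed.

Lemma count_multiples x d : (0 < d)%N ->
  (\sum_(1 <= n < x.+1 | d %| n) 1 = x %/ d)%N.
Proof.
move=> d0; elim: x => [|x IH]; first by rewrite big_geq // div0n.
rewrite big_mkcond big_nat_recr //= -big_mkcond IH divnS // addnC.
by case: (d %| _)%N.
Qed.

Lemma sum_inv_sqr_le (R : realFieldType) x :
  \sum_(1 <= n < x.+1) (n ^ 2)%:R^-1 <= 2 :> R.
Proof.
case: x => [|x]; first by rewrite big_geq.
suff : \sum_(1 <= n < x.+2) (n ^ 2)%:R^-1 <= 2 - x.+1%:R^-1 :> R.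
  by move/le_trans; apply; rewrite gerBl invr_ge0.
elim: x => [|x IH]; first by rewrite big_nat1 exp1n invr1; lra.
rewrite big_nat_recr //=; apply: (le_trans (lerD IH (lexx _))).
have x0 : 0 < x.+1%:R :> R by rewrite ltr0n.
rewrite natrX -[x.+2%:R]natr1; set u := x.+1%:R in x0 *.
have e : (u + 1) ^- 2 <= u^-1 - (u + 1)^-1.
  have -> : u^-1 - (u + 1)^-1 = (u * (u + 1))^-1 by field; rewrite !gt_eqF //; lra.
  by rewrite lef_pV2 ?posrE ?expr2 ?mulr_gt0 //; nra.
by move: e; move: ((u + 1) ^- 2) ((u + 1)^-1) (u^-1) => a b c; lra.
Qed.

Lemma sum_square_divisors_le (R : realFieldType) x z :
  \sum_(1 <= n < x.+1) (\sum_(2 <= p < z.+1 | (p ^ 2 %| n)%N) 1) <= x%:R :> R.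
Proof.
rewrite (exchange_big_dep_nat xpredT) //=.
apply: (@le_trans _ _ (\sum_(2 <= p < z.+1) x%:R * (p ^ 2)%:R^-1)).
  apply: ler_sum_nat => p /andP[p2 _].
  have p0 : (0 < p ^ 2)%N by rewrite expn_gt0; lia.
  have -> : \sum_(1 <= n < x.+1 | (p ^ 2 %| n)%N) 1 = (x %/ p ^ 2)%:R :> R.
    by rewrite -count_multiples // natr_sum.
  by rewrite ler_pdivlMr ?ltr0n // -natrM ler_nat leq_divM.
rewrite -mulr_sumr -[leRHS]mulr1 ler_wpM2l //.
case: z => [|z]; first by rewrite big_geq.
by have := sum_inv_sqr_le R z.+1; rewrite big_ltn //= exp1n invr1; lra.
Qed.

Lemma sum_sigma_div_le (R : realFieldType) x :
  \sum_(1 <= n < x.+1) (sigma n)%:R / n%:R <= 2 * x%:R :> R.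
Proof.
have -> : \sum_(1 <= n < x.+1) (sigma n)%:R / n%:R =
    \sum_(1 <= n < x.+1) \sum_(1 <= d < n.+1 | (d %| n)%N) (n %/ d)%:R^-1 :> R.
  apply: eq_big_nat => n /andP[n1 _]; rewrite sigmaE // natr_sum mulr_suml.
  rewrite big_nat_cond [RHS]big_nat_cond; apply: eq_bigr => d /andP[/andP[d1 _] dn].
  rewrite -[in LHS](divnK dn) natrM invfM mulrCA divff ?mulr1 //.
  by rewrite pnatr_eq0 -lt0n.
rewrite -(sum_hyperbola x (fun _ m => m%:R^-1)) sum_hyperbola_swap mulrC.
apply: (@le_trans _ _ (\sum_(1 <= m < x.+1) x%:R * (m ^ 2)%:R^-1)).
  apply: ler_sum_nat => m /andP[m1 _].
  have mR : 0 < m%:R :> R by rewrite ltr0n.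
  rewrite sumr_const_nat subSS subn0 -[_ *+ (x %/ m)]mulr_natr natrX expr2 invfM.
  by rewrite [leRHS]mulrC -mulrA ler_pM2l ?invr_gt0 // mulrC ler_pdivlMr // -natrM ler_nat leq_divM.
by rewrite -mulr_sumr ler_wpM2l // sum_inv_sqr_le.
Qed.

(** [ln x] may replace [ln n], since it occurs with a nonpositive exponent. [theta] is the power of
    [ln x] granted to [sigma n / n]. *)
Lemma T_bound_suff (R : realType) (delta theta V : R) n x : odd n -> (1 < n <= x)%N ->
  0 <= c' R * (1 - delta) ->
  (sigma n)%:R <= n%:R * expR (theta * ln (ln x%:R)) ->
  V <= (logn 2 (sigma n))%:R ->
  (c' R * (1 - delta) + theta) * ln (ln x%:R) <= ln 2 * V ->
  T_bound delta n.
Proof.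
move=> on /andP[n1 nx] c0 hs hV hE; rewrite /T_bound.
have n0 : (0 < n)%N by lia.
have lnn : 0 < ln n%:R :> R by rewrite ln_gt0 // ltr1n.
have lnx : ln n%:R <= ln x%:R :> R by rewrite ler_ln ?posrE ?ltr0n ?ler_nat //; lia.
have lx : 0 < ln x%:R :> R by exact: lt_le_trans lnx.
have l2 : 0 < ln 2 :> R by rewrite ln_gt0 // ltr1n.
set v := logn 2 (sigma n) in hV *.
have TE : (T n)%:R = (sigma n)%:R * expR (- (ln 2 * v%:R)) :> R.
  have h : (T n * 2 ^ v = sigma n)%N by rewrite /T divnK // pfactor_dvdnn.
  have p2 : expR (ln 2 * v%:R) = (2 ^ v)%:R :> R.
    by rewrite expRM_natr lnK ?posrE // natrX.
  by rewrite expRN p2 -h natrM mulfK // pnatr_eq0 -lt0n expn_gt0.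
rewrite TE /powR gt_eqF //.
apply: (@le_trans _ _ (n%:R * expR (theta * ln (ln x%:R)) * expR (- (ln 2 * v%:R)))).
  by rewrite ler_wpM2r // expR_ge0.
rewrite -mulrA -expRD ler_wpM2l // ler_expR.
have h1 : ln (ln n%:R) <= ln (ln x%:R) :> R by rewrite ler_ln ?posrE.
have h2 : ln 2 * V <= ln 2 * v%:R by rewrite ler_wpM2l // ltW.
have := ler_wpM2l c0 h1; lra.
Qed.

(** * Counting the exceptions *)

Lemma exists_sqrt_floor x : exists z, (z * z <= x < z.+1 * z.+1)%N.
Proof.
elim: x => [|x [z /andP[h1 h2]]]; first by exists 0%N.
have [h3|h3] := ltnP x.+1 (z.+1 * z.+1); first by exists z; lia.
exists z.+1; nia.
Qed.

Lemma lnln_unbounded (R : realType) (A : R) : exists x0 : nat, forall x, (x0 <= x)%N ->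
  A <= ln (ln x%:R).
Proof.
have [n hn] := natr_unbounded (expR (expR A)).
exists n => x nx; have hx : expR (expR A) <= x%:R :> R.
  by apply: le_trans (ltW hn) _; rewrite ler_nat.
have x0 : 0 < x%:R :> R by exact: lt_le_trans (expR_gt0 _) hx.
have h1 : expR A <= ln x%:R by rewrite -(expRK (expR A)) ler_ln ?posrE ?expR_gt0.
rewrite -{1}(expRK A) ler_ln ?posrE ?expR_gt0 //; exact: lt_le_trans (expR_gt0 _) h1.
Qed.

Lemma exists_large_weight_mean (R : realType) (delta : R) : 0 < delta ->
  exists K x0, forall x, (x0 <= x)%N -> exists2 z, (z * z <= x)%N &
    (2 - delta) * ln (ln x%:R) <= weight_mean R K z.
Proof.
move=> d0.
(* Half of [delta] pays for the cap [K], the other half for [2 * ln 4] and [C], which [ln (ln x)]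
   eventually outgrows. *)
have [K hK] : exists K, 2 / (2 ^ K)%:R <= delta / 2.
  have [K hK] := natr_unbounded (4 / delta); exists K.
  rewrite ler_pdivrMr ?ltr0n ?expn_gt0 // -ler_pdivrMl ?divr_gt0 //.
  have : K%:R <= (2 ^ K)%:R :> R by rewrite ler_nat ltnW // ltn_expl.
  by apply: le_trans; apply: le_trans (ltW hK); rewrite invf_div; lra.
have [C hC] := weight_mean_ge R K.
have l4 : 0 < ln 4 :> R by rewrite ln_gt0 // ltr1n.
have [x1 hx1] := lnln_unbounded (ln 4 + (2 / delta) * (2 * ln 4 + `|C|)).
exists K, (x1 + 4)%N => x hx.
have [x4 x1x] : (4 <= x)%N /\ (x1 <= x)%N by lia.
have [z /andP[zx xz]] := exists_sqrt_floor x; exists z => //.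
have z2 : (2 <= z)%N by clear -xz x4; nia.
have xR : 0 < x%:R :> R by rewrite ltr0n; exact: leq_trans x4.
have zl : ln (ln x%:R) - ln 4 <= ln (ln z%:R) :> R.
  have zR : 0 < z%:R :> R by rewrite ltr0n ltnW.
  have lz : 0 < ln z%:R :> R by rewrite ln_gt0 // ltr1n.
  (* Since [z >= 2], [x < (z + 1)^2 <= z^4]; the crude exponent only changes an additive
     constant. *)
  have xz4 : ln x%:R <= 4 * ln z%:R :> R.
    rewrite mulr_natl -lnXn // ler_ln ?posrE ?exprn_gt0 // -natrX ler_nat.
    by rewrite (leq_trans (ltnW xz)) // !expnS expn0; clear -z2; nia.
  have lx : 0 < ln x%:R :> R by rewrite ln_gt0 // ltr1n; exact: leq_trans x4.
  by rewrite lerBlDl -lnM ?posrE // ler_ln ?posrE ?mulr_gt0.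
apply: le_trans (hC z z2).
have := hx1 x x1x; set l := ln (ln x%:R) in zl *; clear -hK d0 l4 zl => hl.
have nn : 0 <= (2 / delta) * (2 * ln 4 + `|C|).
  by rewrite mulr_ge0 ?divr_ge0 ?addr_ge0 ?mulr_ge0 // ltW.
have lC : 2 * ln 4 + `|C| <= (delta / 2) * l.
  have : (2 / delta) * (2 * ln 4 + `|C|) <= l by lra.
  by rewrite -ler_pdivlMl ?divr_gt0 // invf_div.
have := ler_norm C; set s := 2 - 2 / _.
have s1 : 2 - delta / 2 <= s by rewrite /s; move: hK; lra.
have s2 : s <= 2 by rewrite /s gerBl divr_ge0.
have s0 : 0 <= s.
  by rewrite /s subr_ge0 ler_pdivrMr ?ltr0n ?expn_gt0 // ler_peMr // ler1n expn_gt0.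
have h1 := ler_wpM2l s0 zl.
have h2 : (2 - delta / 2) * l <= s * l by rewrite ler_wpM2r //; lra.
have h3 : s * ln 4 <= 2 * ln 4 by rewrite ler_wpM2r // ltW.
move: lC h1 h2 h3; clear; rewrite mulrBr; lra.
Qed.

(** Three Chebyshev-Markov ratios, for the distance from the mean, the square divisors and the size
    of [sigma n / n]. With suitable [e] and [M] their sum is at least 1 at each exception [n > 1],
    so its total bounds the number of exceptions. *)
Definition exception_cost (R : realType) (K z : nat) (e M : R) (n : nat) : R :=
  (\sum_(1 <= p < z.+1 | (p %| n)%N) (weight K p)%:R - weight_mean R K z) ^+ 2 / e ^+ 2
  + K%:R * (\sum_(2 <= p < z.+1 | (p ^ 2 %| n)%N) 1) / e + (sigma n)%:R / n%:R / M.

Lemma exception_cost_ge0 (R : realType) K z (e M : R) n : 0 < e -> 0 < M ->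
  0 <= exception_cost K z e M n.
Proof.
move=> e0 M0; rewrite /exception_cost !addr_ge0 ?divr_ge0 ?sqr_ge0 ?(ltW e0) ?(ltW M0) //.
by rewrite mulr_ge0 // sumr_ge0.
Qed.

(** If all three ratios are below 1, the valuation exceeds [E - 2 * (delta / 8 * E) = (1 - delta /
    4) * E]. As [(1 - delta / 4) * (2 - delta) >= 2 - 3 * delta / 2], this covers the required
    [2 * (1 - delta)] and leaves [delta / 2] for [sigma n / n]: hence both constants. *)
Lemma exception_cost_ge1 (R : realType) (delta : R) (K z x n : nat) :
  0 < delta -> delta < 1 -> odd n -> (1 < n <= x)%N ->
  0 < weight_mean R K z -> (2 - delta) * ln (ln x%:R) <= weight_mean R K z ->
  ~ T_bound delta n ->
  1 <= exception_cost K z (delta / 8 * weight_mean R K z)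
         (expR (ln 2 * delta / 2 * ln (ln x%:R))) n.
Proof.
move=> d0 d1 on nx E0 El; apply: contra_notT; rewrite -ltNge /exception_cost.
have hv := sum_weight_le K z on; rewrite -(ler_nat R) natrD natrM !natr_sum in hv.
move: hv; have /andP[n1 _] := nx; have nR : 0 < n%:R :> R by rewrite ltr0n ltnW.
set E := weight_mean R K z in E0 El *; set l := ln (ln x%:R) in El *.
set f := \sum_(_ <= _ < _ | _) _; set r := \sum_(_ <= _ < _ | _) _ => hv.
have M0 := expR_gt0 (ln 2 * delta / 2 * l).
set M := expR _ in M0 *; have e0 : 0 < delta / 8 * E by rewrite mulr_gt0 // divr_gt0.
have c1 : 0 <= (f - E) ^+ 2 / (delta / 8 * E) ^+ 2 by rewrite divr_ge0 ?sqr_ge0.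
have c2 : 0 <= K%:R * r / (delta / 8 * E).
  by rewrite divr_ge0 ?(ltW e0) // mulr_ge0 // sumr_ge0.
have c3 : 0 <= (sigma n)%:R / n%:R / M by rewrite !divr_ge0 // ltW.
have split3 (a b c : R) : 0 <= a -> 0 <= b -> 0 <= c -> a + b + c < 1 ->
    [/\ a < 1, b < 1 & c < 1] by clear; move=> *; split; lra.
move=> hlt; have [] := split3 _ _ _ c1 c2 c3 hlt.
rewrite !ltr_pdivrMr ?exprn_gt0 // !mul1r => s1 s2; rewrite mulrC => s3.
have s4 : E - delta / 8 * E < f.
  move: s1; rewrite -ltr_sqrt ?exprn_gt0 // !sqrtr_sqr (gtr0_norm e0) ltr_norml.
  by clear; lra.
apply: (@T_bound_suff R delta (ln 2 * delta / 2) (E - 2 * (delta / 8 * E)) n x on nx).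
- by rewrite /c' mulr_ge0 ?mulr_ge0 ?subr_ge0 ?(ltW d1) // ln_ge0 // ler1n.
- exact: ltW.
- by move: hv s4 s2; clear; lra.
- rewrite -/l /c'.
  have -> : (2 * ln 2 * (1 - delta) + ln 2 * delta / 2) * l =
    ln 2 * ((2 - 3 * delta / 2) * l) by clear; field.
  have h : (2 - 3 * delta / 2) * l <= (1 - delta / 4) * E.
    have [l0|l0] := leP 0 l; last first.
      apply: (@le_trans _ _ 0); last by rewrite mulr_ge0 ?(ltW E0) //; move: d1; clear; lra.
      by rewrite mulr_ge0_le0 ?(ltW l0) //; move: d1; clear; lra.
    have q : 0 <= 1 - delta / 4 by move: d1; clear; lra.
    apply: le_trans (ler_wpM2l q El); rewrite mulrA ler_wpM2r //.
    by have := sqr_ge0 delta; rewrite expr2; clear; lra.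
  have -> : E - 2 * (delta / 8 * E) = (1 - delta / 4) * E by clear; field.
  by rewrite ler_wpM2l // ln_ge0 // ler1n.
Qed.

Lemma sum_exception_cost (R : realType) (K z x : nat) (e M : R) :
  (z * z <= x)%N -> 0 < e -> 0 < M ->
  \sum_(1 <= n < x.+1 | odd n) exception_cost K z e M n <=
  x%:R * ((K%:R * weight_mean R K z + 4 * K%:R ^+ 2) / e ^+ 2 + K%:R / e + 2 / M).
Proof.
move=> zx e0 M0; rewrite !big_split /= -!mulr_suml -mulr_sumr 2!mulrDr.
apply: lerD; first apply: lerD.
- by rewrite mulrA ler_wpM2r ?invr_ge0 ?sqr_ge0 //; exact: turan_variance.
- rewrite mulrA ler_wpM2r ?invr_ge0 ?(ltW e0) // mulrC ler_wpM2r //.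
  apply: le_trans (sum_square_divisors_le R x z).
  by rewrite big_mkcond ler_sum // => n _; case: ifP => // _; exact: sumr_ge0.
- rewrite mulrA ler_wpM2r ?invr_ge0 ?(ltW M0) // [leRHS]mulrC.
  apply: le_trans (sum_sigma_div_le R x).
  by rewrite big_mkcond ler_sum // => n _; case: ifP => // _; rewrite divr_ge0.
Qed.

Lemma few_exceptions (R : realType) (delta eta : R) :
  0 < delta -> delta < 1 -> 0 < eta ->
  exists x0, forall x, (x0 <= x)%N ->
    \sum_(1 <= n < x.+1 | odd n && ~~ `[<T_bound delta n>]) 1 <= eta * x%:R.
Proof.
move=> d0 d1 eta0; have [K [x1 hE]] := exists_large_weight_mean d0.
pose k : R := K%:R; pose eps := delta / 8; pose theta := ln 2 * delta / 2 : R.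
have k0 : 0 <= k by [].
have eps0 : 0 < eps by rewrite divr_gt0.
have l2 : 0 < ln 2 :> R by rewrite ln_gt0 // ltr1n.
have th0 : 0 < theta by rewrite divr_gt0 // mulr_gt0.
(* [H / l] will bound the mean cost: [E >= l >= 1] handles the first two ratios and [M >= theta * l]
   the third. *)
pose H := (k + 4 * k ^+ 2) / eps ^+ 2 + k / eps + 2 / theta.
have H0 : 0 <= H.
  rewrite /H !addr_ge0 // divr_ge0 ?sqr_ge0 ?(ltW eps0) ?(ltW th0) // addr_ge0 //.
  by rewrite mulr_ge0 // sqr_ge0.
have [x2 hx2] := lnln_unbounded (1 + 2 * H / eta).
have [x3 hx3] := natr_unbounded (2 / eta).
exists (x1 + x2 + x3 + 1)%N => x hx.
have [x1x x2x x3x x0] : [/\ x1 <= x, x2 <= x, x3 <= x & 0 < x]%N.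
  by clear -hx; split; lia.
have {hx3} hx3 : 1 <= x%:R * (eta / 2).
  have : 2 / eta <= x%:R by apply: (le_trans (ltW hx3)); rewrite ler_nat.
  by rewrite ler_pdivrMr //; clear; lra.
have [z zx El] := hE x x1x; have := hx2 x x2x.
set E := weight_mean R K z in El *; set l := ln (ln x%:R) in El * => hl.
have l1 : 1 <= l.
  apply: le_trans hl; rewrite lerDl divr_ge0 ?mulr_ge0 // ltW //.
have lH : H / l <= eta / 2.
  have : 2 * H / eta <= l by move: hl; clear; lra.
  have l0 : 0 < l by move: l1; clear; lra.
  by rewrite !ler_pdivrMr //; clear; lra.
have lE : l <= E.
  by apply: le_trans El; rewrite ler_peMl; move: l1 d1; clear; lra.
have E0 : 0 < E by move: l1 lE; clear; lra.
have e0 : 0 < eps * E by rewrite mulr_gt0.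
have M0 := expR_gt0 (theta * l); set M := expR _ in M0.
(* The 1 pays for [n = 1], where [exception_cost_ge1] does not apply; [hx3] absorbs it. *)
apply: (@le_trans _ _ (1 + \sum_(1 <= n < x.+1 | odd n) exception_cost K z (eps * E) M n)).
  rewrite big_mkcond [X in _ <= 1 + X]big_mkcond !(@big_ltn _ _ _ 1) //=.
  apply: lerD; first by case: ifP.
  rewrite -[leLHS]add0r; apply: lerD; first exact: exception_cost_ge0.
  apply: ler_sum_nat => n /andP[n1 nx]; have [on|_] //= := boolP (odd n).
  case: asboolP => [_|nT] /=; first exact: exception_cost_ge0.
  by apply: (exception_cost_ge1 d0 d1 on _ E0 El nT); rewrite n1.
have := sum_exception_cost K zx e0 M0; rewrite -/E -/k => hsum.
have hH : (k * E + 4 * k ^+ 2) / (eps * E) ^+ 2 + k / (eps * E) + 2 / M <= H / l.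
  have l0 : 0 < l by move: l1; clear; lra.
  have invE : E^-1 <= l^-1 by rewrite lef_pV2.
  have -> : H / l = (k + 4 * k ^+ 2) / eps ^+ 2 / l + k / eps / l + 2 / theta / l.
    by rewrite /H 2!(mulrDl _ _ l^-1).
  apply: lerD; first apply: lerD.
  - apply: (@le_trans _ _ ((k + 4 * k ^+ 2) / eps ^+ 2 / E)); last first.
      by rewrite ler_wpM2l // divr_ge0 ?sqr_ge0 // addr_ge0 // mulr_ge0 // sqr_ge0.
    have -> : (k + 4 * k ^+ 2) / eps ^+ 2 / E = (k + 4 * k ^+ 2) * E / (eps * E) ^+ 2.
      by clear -eps0 E0; field; rewrite !gt_eqF.
    rewrite ler_wpM2r ?invr_ge0 ?sqr_ge0 // [leRHS]mulrDl lerD2l.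
    by rewrite ler_peMr ?mulr_ge0 ?sqr_ge0 //; apply: le_trans lE.
  - by rewrite invfM mulrA ler_wpM2l // divr_ge0 // ltW.
  - rewrite -mulrA -invfM ler_wpM2l // lef_pV2 ?posrE ?mulr_gt0 //.
    by apply: le_trans (expR_ge1Dx _); rewrite lerDr.
have := le_trans hsum (ler_wpM2l (ler0n R x) (le_trans hH lH)).
by move: hx3; clear; lra.
Qed.

(** * From counts to relative density *)

Lemma count_uptoE (R : realType) (A : set nat) (x : R) : 0 <= x ->
  count_upto A x = (\sum_(1 <= n < (Num.truncn x).+1 | `[<A n>]) 1)%N.
Proof.
move=> x0; rewrite sum1_count -size_filter /count_upto.
set s := [seq n <- index_iota 1 (Num.truncn x).+1 | `[<A n>]].
have -> : A `&` [set n : nat | (1 <= n)%N /\ n%:R <= x] = [set` [fset n | n in s]%fset].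
  apply/seteqP; split => n /=; rewrite inE /= mem_filter mem_index_iota ltnS -truncn_ge_nat //.
    by case=> /asboolP An [n1 nx]; apply/and3P.
  by case/and3P => /asboolP.
by rewrite set_fsetK card_fseq undup_id // filter_uniq // iota_uniq.
Qed.

Lemma count_upto_odd_ge (R : realType) (x : R) : 0 <= x ->
  (Num.truncn x <= 2 * count_upto odd_set x)%N.
Proof.
move=> x0; rewrite count_uptoE //.
have -> : (\sum_(1 <= n < (Num.truncn x).+1 | `[<odd_set n>]) 1 = uphalf (Num.truncn x))%N.
  rewrite -[Num.truncn x in RHS]divn1 -count_odd_multiples //.
  apply: eq_bigl => n; rewrite dvd1n andbT; apply/asboolP/idP => //.
lia.
Qed.

Lemma odd_density0 (R : realType) (P : nat -> Prop) :
  (forall eta : R, 0 < eta -> exists x0, forall x, (x0 <= x)%N ->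
     \sum_(1 <= n < x.+1 | odd n && ~~ `[<P n>]) 1 <= eta * x%:R) ->
  almost_all_odd R P.
Proof.
move=> few; apply/cvgrPdist_le => /= e e0.
(* The halving is made good by the odd integers being at least half of all those up to [x]. *)
have [x0 hx0] := few (e / 2) (divr_gt0 e0 (ltr0n R 2)).
near=> x.
have xx0 : x0.+1%:R <= x by near: x; exact: nbhs_pinfty_ge.
have x_ge0 : 0 <= x by apply: le_trans xx0.
have tx : (x0.+1 <= Num.truncn x)%N by rewrite truncn_ge_nat.
rewrite sub0r normrN ger0_norm ?divr_ge0 //.
have c0 : 0 < (count_upto odd_set x)%:R :> R.
  by rewrite ltr0n; have := count_upto_odd_ge x_ge0; move: tx; clear; lia.
rewrite ler_pdivrMr // count_uptoE //.
have -> : (\sum_(1 <= n < (Num.truncn x).+1 | `[<[set n | odd n /\ ~ P n] n>]) 1)%:R =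
    \sum_(1 <= n < (Num.truncn x).+1 | odd n && ~~ `[<P n>]) 1 :> R.
  rewrite natr_sum; apply: eq_bigl => n.
  by apply/asboolP/andP => -[on /asboolPn].
apply: (le_trans (hx0 _ (ltnW tx))).
rewrite -mulrA ler_wpM2l ?(ltW e0) // ler_pdivrMl // -natrM ler_nat.
exact: count_upto_odd_ge.
Unshelve. all: by end_near. Qed.

Lemma odd_density1 (R : realType) (P : nat -> Prop) :
  almost_all_odd R P -> has_odd_density [set n | odd n /\ P n] (1 : R).
Proof.
move=> /cvgrPdist_le h; apply/cvgrPdist_le => /= e e0; near=> x.
have x1 : 1 <= x by near: x; exact: nbhs_pinfty_ge.
have x0 : 0 <= x by apply: le_trans x1.
have c0 : (count_upto odd_set x)%:R != 0 :> R.
  rewrite pnatr_eq0 -lt0n; have := count_upto_odd_ge x0.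
  by have : (0 < Num.truncn x)%N := (etrans (truncn_gt0 x) x1); clear; lia.
have E : 0 - (count_upto [set n | odd n /\ ~ P n] x)%:R / (count_upto odd_set x)%:R
    = (count_upto [set n | odd n /\ P n] x)%:R / (count_upto odd_set x)%:R - 1 :> R.
  rewrite sub0r -[X in _ = _ - X](divff c0) -mulrBl -mulNr; congr (_ / _).
  have -> : count_upto odd_set x = (count_upto [set n | odd n /\ P n] x +
      count_upto [set n : nat | odd n /\ ~ P n] x)%N.
    rewrite !count_uptoE // big_mkcond [in RHS]big_mkcond [X in (_ + X)%N]big_mkcond.
    rewrite -big_split /=; apply: eq_bigr => n _.
    have -> : `[<odd_set n>] = odd n by apply/asboolP/idP.
    have -> : `[<[set n | odd n /\ P n] n>] = odd n && `[<P n>].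
      by apply/asboolP/andP => -[on /asboolP].
    have -> : `[<[set n | odd n /\ ~ P n] n>] = odd n && ~~ `[<P n>].
      by apply/asboolP/andP => -[on /asboolPn].
    by case: (odd n); case: `[<P n>].
  by rewrite natrD opprD addrA subrr sub0r.
by rewrite distrC -E; near: x; exact: h.
Unshelve. all: by end_near. Qed.

Lemma G_E (R : realType) (delta : R) : delta < 1 ->
  G delta = [set n | odd n /\ T_bound delta n].
Proof.
move=> d1; apply/seteqP; split => n /= [on]; first by move=> _ Tn.
move=> Tn; split=> //; case: n on Tn => [|[|[|n]]] //= _.
(* Here [delta < 1] matters: with exponent 0 the power would be 1 and [n = 1] would satisfy the
   bound. *)
rewrite /T_bound ln1 powR0 ?mulr0.
  have -> : T 1 = 1%N by rewrite /T /sigma big_cons big_nil.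
  by rewrite lern0.
rewrite oppr_eq0 mulf_neq0 ?mulf_neq0 ?subr_eq0 ?gt_eqF //.
by rewrite ln_gt0 // ltr1n.
Qed.

Unset Implicit Arguments.

Theorem theorem3p7 (R : realType) (delta : R) (hdelta0 : 0 < delta)
    (hdelta1 : delta < 1) :
  has_odd_density (G delta) (1 : R) /\ almost_all_odd R (T_bound delta).
Proof.
have h : almost_all_odd R (T_bound delta).
  by apply: odd_density0 => eta; exact: few_exceptions.
by split=> //; rewrite G_E //; exact: odd_density1.
Qed.
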